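(* (ZF) Let $\mathbf p=(\mathbb D,\mathrm{rk},\Sigma,\mathbf j,\mu)$ be a strict rank 1-system, or just a strict rank 2-system. Then for every ordinal $\zeta$ there is $i<\mathrm{cf}(\mu)$ such that for every $\mathbf d\in\mathbb D_{\ge i}$ we have $\mathrm{rk}_{\mathbf d}(\zeta)=\zeta$, that is, $\mathrm{rk}_{\mathbf d}(\langle\zeta:s\in Y_{\mathbf d}\rangle)=\zeta$.
   Context: The base theory is ZF. Filters are proper. For a set $A$, $\theta(A)$ is the least (non-zero) ordinal $\alpha$ such that there is no function from $A$ onto $\alpha$. For a filter $D$ on $Y$ and $f,g:Y\to\mathrm{Ord}$, ''$f<g$ mod $D$'' (or $f<_D g$) means $\{s\in Y:f(s)<g(s)\}\in D$; similarly for $\le$, $=$. ${}^{Y}\mathrm{Ord}$ is the class of functions from $Y$ to the ordinals. **Weak rank 1-system.** $\mathbf p=(\mathbb D,\mathrm{rk},\Sigma,\mathbf j,\mu)$ is a weak rank 1-system when: (a) $\mu$ is a singular cardinal. (b) Each $\mathbf d\in\mathbb D$ is (or determines) a pair $(Y_{\mathbf d},D_{\mathbf d})$, where $D_{\mathbf d}$ is a filter on the set $Y_{\mathbf d}$ and $\theta(Y_{\mathbf d})<\mu$. (c) For each $\mathbf d\in\mathbb D$, $\mathrm{rk}_{\mathbf d}$ is a (definable) function with domain ${}^{Y_{\mathbf d}}\mathrm{Ord}$ and values in $\mathrm{Ord}$. For an ordinal $\alpha$, $\mathrm{rk}_{\mathbf d}(\alpha)$ means $\mathrm{rk}_{\mathbf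 d}$ of the constant function $\alpha$ on $Y_{\mathbf d}$. (d) $\Sigma$ is a function with domain $\mathbb D$ with $\Sigma(\mathbf d)\subseteq\mathbb D$, and $Y_{\mathbf e}=Y_{\mathbf d}$ for $\mathbf e\in\Sigma(\mathbf d)$. (e) $\mathbf j$ is a function from $\mathbb D$ onto $\mathrm{cf}(\mu)$; $\mathbb D_{\ge i}:=\{\mathbf d\in\mathbb D:\mathbf j(\mathbf d)\ge i\}$; and $\mathbf e\in\Sigma(\mathbf d)$ implies $\mathbf j(\mathbf e)\ge\mathbf j(\mathbf d)$. (f) For every $\sigma<\mu$ there is $i<\mathrm{cf}(\mu)$ such that every $\mathbf d\in\mathbb D_{\ge i}$ is $(\mathbf p,\le\sigma)$-complete. Here $\mathbf d$ is $(\mathbf p,\le X)$-complete when: if $f\in{}^{Y_{\mathbf d}}\mathrm{Ord}$, $\zeta=\mathrm{rk}_{\mathbf d}(f)$ and $\langle A_j:j\in X\rangle$ is a partition of $Y_{\mathbf d}$, then for some $\mathbf e\in\Sigma(\mathbf d)$ and $j\in X$ we have $A_j\in D_{\mathbf e}$ and $\mathrm{rk}_{\mathbf e}(f)=\zeta$. (g) (no hole) If $\mathrm{rk}_{\mathbf d}(f)>\zeta$, then for some $\mathbf e\in\Sigma(\mathbf d)$ and $g$ we have $g<_{D_{\mathbf e}}f$ and $\mathrm{rk}_{\mathbf e}(g)=\zeta$. (h) If $f=g+1$ mod $D_{\mathbf d}$ then $\mathrm{rk}_{\mathbf d}(f)=\mathrm{rk}_{\mathbf d}(g)+1$. (i)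 If $f\le g$ mod $D_{\mathbf d}$ then $\mathrm{rk}_{\mathbf d}(f)\le\mathrm{rk}_{\mathbf d}(g)$. **Weak rank 2-system.** $\mathbf p=(\mathbb D,\mathrm{rk},\Sigma,\mathbf j,\mu)$ is a weak rank 2-system when: (a) $\mu$ is a singular cardinal. (b) Each $\mathbf d\in\mathbb D$ is (or determines) a pair $(Y_{\mathbf d},D_{\mathbf d})$, where $D_{\mathbf d}$ is a filter on the set $Y_{\mathbf d}$ and $\theta(Y_{\mathbf d})<\mu$. (c) For each $\mathbf d\in\mathbb D$, $\mathrm{rk}_{\mathbf d}$ is a (definable) function with domain ${}^{Y_{\mathbf d}}\mathrm{Ord}$ and values in $\mathrm{Ord}$. For an ordinal $\alpha$, $\mathrm{rk}_{\mathbf d}(\alpha)$ means $\mathrm{rk}_{\mathbf d}$ of the constant function $\alpha$ on $Y_{\mathbf d}$. (d)' $\Sigma$ is a function with domain $\mathbb D$, and for $\mathbf d\in\mathbb D$, $\Sigma(\mathbf d)\subseteq\{(\mathbf e,h):\mathbf e\in\mathbb D_{\ge\mathbf j(\mathbf d)},\ h:Y_{\mathbf e}\to Y_{\mathbf d}\}$ (writing $\mathbf e\in\Sigma(\mathbf d)$ means $(\mathbf e,h)\in\Sigma(\mathbf d)$ for some $h$). (e) $\mathbf j$ is a function from $\mathbb D$ onto $\mathrm{cf}(\mu)$; $\mathbb D_{\ge i}:=\{\mathbf d\in\mathbb D:\mathbf j(\mathbf d)\ge i\}$; and $(\mathbf e,h)\in\Sigma(\mathbf d)$ implies $\mathbf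 j(\mathbf e)\ge\mathbf j(\mathbf d)$. (f)' For every $\sigma<\mu$ there is $i<\mathrm{cf}(\mu)$ such that every $\mathbf d\in\mathbb D_{\ge i}$ is $(\mathbf p,\le\sigma)$-complete, where now $\mathbf d$ is $(\mathbf p,\le X)$-complete when: if $f\in{}^{Y_{\mathbf d}}\mathrm{Ord}$, $\zeta=\mathrm{rk}_{\mathbf d}(f)$ and $\langle A_j:j\in X\rangle$ is a partition of $Y_{\mathbf d}$, then for some $(\mathbf e,h)\in\Sigma(\mathbf d)$ and $j\in X$ we have $h^{-1}(A_j)\in D_{\mathbf e}$ and $\mathrm{rk}_{\mathbf e}(f\circ h)=\zeta$. (g)' If $\mathrm{rk}_{\mathbf d}(f)>\zeta$, then for some $(\mathbf e,h)\in\Sigma(\mathbf d)$ and $g\in{}^{Y_{\mathbf e}}\mathrm{Ord}$ we have $g<f\circ h$ mod $D_{\mathbf e}$ and $\mathrm{rk}_{\mathbf e}(g)=\zeta$. (h) If $f=g+1$ mod $D_{\mathbf d}$ then $\mathrm{rk}_{\mathbf d}(f)=\mathrm{rk}_{\mathbf d}(g)+1$. (i) If $f\le g$ mod $D_{\mathbf d}$ then $\mathrm{rk}_{\mathbf d}(f)\le\mathrm{rk}_{\mathbf d}(g)$. **Strict.** For $\iota\in\{1,2\}$, a strict (rank) $\iota$-system is a weak rank $\iota$-system that also satisfies: (j) For every $\mathbf d\in\mathbb D$, ordinals $\zeta,\xi$, function $f$ and $j_0$ satisfying - $f\in{}^{Y_{\mathbf d}}\xi$ (i.e. $f:Y_{\mathbf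 d}\to\xi$), $\mathrm{rk}_{\mathbf d}(f)=\zeta$, $\xi<\zeta$, $\mathrm{cf}(\zeta)=\mathrm{cf}(\mu)$, $j_0<\mathrm{cf}(\mu)$, and - $\mathrm{rk}_{\mathbf e'}(f(s))=f(s)$ for all $s\in Y_{\mathbf d}$ and $\mathbf e'\in\mathbb D_{\ge j_0}$, there is $j$ with $j_0\le j<\mathrm{cf}(\mu)$ such that there are no $\mathbf e,g$ with $\mathbf e\in\mathbb D_{\ge j}$, $g:Y_{\mathbf e}\to\zeta$, $\{g(t):t\in Y_{\mathbf e}\}\subseteq[\xi,\zeta_* )$ for some $\zeta_*<\zeta$, and $\mathrm{rk}_{\mathbf e}(g)\ge\zeta$. *)

(* Defs.v *)
(* The theorem is one of ZF, without choice.  It is therefore stated about an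
   arbitrary model [M] of first-order ZF, with every set-theoretic notion
   interpreted inside [M] and with "class" meaning "definable over [M] with
   parameters".  Choice principles of the metatheory thus give no choice
   function in [M]. *)

Set Implicit Arguments.
Unset Strict Implicit.

Record structure := Structure {
  carrier :> Type;
  mem : carrier -> carrier -> Prop }.

Notation "x ∈ y" := (mem x y) (at level 70, no associativity).

(* First-order formulas of set theory, with de Bruijn indices. *)

Inductive formula : Type :=
| FMem : nat -> nat -> formula
| FEq : nat -> nat -> formula
| FBot : formula
| FAnd : formula -> formula -> formula
| FOr : formula -> formula -> formula
| FImp : formula -> formula -> formula
| FAll : formula -> formula
| FEx : formula -> formula.

Definition scons (T : Type) (x : T) (env : nat -> T) (n : nat) : T :=
  match n with O => x | S k => env k end.

Notation "x .: env" := (scons x env) (at level 55, right associativity).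

Fixpoint sat (M : structure) (env : nat -> M) (phi : formula) : Prop :=
  match phi with
  | FMem m n => env m ∈ env n
  | FEq m n => env m = env n
  | FBot => False
  | FAnd a b => sat env a /\ sat env b
  | FOr a b => sat env a \/ sat env b
  | FImp a b => sat env a -> sat env b
  | FAll a => forall x : M, sat (x .: env) a
  | FEx a => exists x : M, sat (x .: env) a
  end.

(* The environment supplies the parameters. *)

Definition definable1 (M : structure) (P : M -> Prop) : Prop :=
  exists (phi : formula) (env : nat -> M),
    forall x : M, P x <-> sat (x .: env) phi.

Definition definable2 (M : structure) (P : M -> M -> Prop) : Prop :=
  exists (phi : formula) (env : nat -> M),
    forall x y, P x y <-> sat (x .: y .: env) phi.

Definition definable3 (M : structure) (P : M -> M -> M -> Prop) : Prop :=
  exists (phi : formula) (env : nat -> M),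
    forall x y z, P x y z <-> sat (x .: y .: z .: env) phi.

Definition is_empty (M : structure) (x : M) : Prop := forall z : M, ~ z ∈ x.

Definition subset (M : structure) (x y : M) : Prop :=
  forall z : M, z ∈ x -> z ∈ y.

(* [b] is [a ∪ {a}]. *)
Definition is_succ (M : structure) (a b : M) : Prop :=
  forall z : M, z ∈ b <-> z ∈ a \/ z = a.

Record ZF (M : structure) : Prop := {
  ZF_extensionality :
    forall x y : M, (forall z : M, z ∈ x <-> z ∈ y) -> x = y;
  ZF_foundation :
    forall x : M, ~ is_empty x ->
      exists y : M, y ∈ x /\ forall z : M, z ∈ y -> ~ z ∈ x;
  ZF_pairing :
    forall a b : M, exists p : M, forall z : M, z ∈ p <-> z = a \/ z = b;
  ZF_union :
    forall a : M, exists u : M, forall z : M,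
      z ∈ u <-> exists y : M, y ∈ a /\ z ∈ y;
  ZF_power :
    forall a : M, exists p : M, forall z : M, z ∈ p <-> subset z a;
  ZF_infinity :
    exists w : M,
      (exists e : M, is_empty e /\ e ∈ w) /\
      (forall x : M, x ∈ w -> exists y : M, is_succ x y /\ y ∈ w);
  ZF_separation :
    forall (phi : formula) (env : nat -> M) (a : M),
      exists b : M, forall z : M, z ∈ b <-> z ∈ a /\ sat (z .: env) phi;
  ZF_replacement :
    forall (phi : formula) (env : nat -> M) (a : M),
      (forall x y y' : M, x ∈ a ->
         sat (x .: y .: env) phi -> sat (x .: y' .: env) phi -> y = y') ->
      exists b : M, forall y : M,
        y ∈ b <-> exists x : M, x ∈ a /\ sat (x .: y .: env) phi }.

(* Ordered pairs (Kuratowski) and functions as sets of pairs. *)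

Definition is_upair (M : structure) (p a b : M) : Prop :=
  forall z : M, z ∈ p <-> z = a \/ z = b.

Definition is_opair (M : structure) (p a b : M) : Prop :=
  exists u v : M, is_upair u a a /\ is_upair v a b /\ is_upair p u v.

(* [f(x) = y] *)
Definition app (M : structure) (f x y : M) : Prop :=
  exists p : M, is_opair p x y /\ p ∈ f.

(* [f] is a (set) function with domain the set [A] and values in the class [B]. *)
Definition maps (M : structure) (f A : M) (B : M -> Prop) : Prop :=
  (forall p : M, p ∈ f -> exists x y : M, is_opair p x y /\ x ∈ A /\ B y) /\
  (forall x : M, x ∈ A -> exists! y : M, app f x y).

Definition maps_into (M : structure) (f A B : M) : Prop :=
  maps f A (fun y => y ∈ B).

Definition onto (M : structure) (f A B : M) : Prop :=
  maps_into f A B /\ forall y : M, y ∈ B -> exists x : M, x ∈ A /\ app f x y.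

Definition bijection (M : structure) (f A B : M) : Prop :=
  onto f A B /\ forall x x' y : M, app f x y -> app f x' y -> x = x'.

Definition is_const (M : structure) (f A a : M) : Prop :=
  maps f A (fun y => y = a).

(* [k] is [f ∘ h]. *)
Definition is_comp (M : structure) (k f h : M) : Prop :=
  forall p : M, p ∈ k <->
    exists t s a : M, is_opair p t a /\ app h t s /\ app f s a.

(* Under foundation, a transitive set linearly ordered by membership is
   well-ordered by it. *)
Definition Ord (M : structure) (x : M) : Prop :=
  (forall y : M, y ∈ x -> subset y x) /\
  (forall y z : M, y ∈ x -> z ∈ x -> y ∈ z \/ y = z \/ z ∈ y).

Definition ole (M : structure) (a b : M) : Prop := a ∈ b \/ a = b.

Definition limit_ord (M : structure) (x : M) : Prop :=
  Ord x /\ ~ is_empty x /\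
  forall y : M, y ∈ x -> exists z : M, z ∈ x /\ y ∈ z.

Definition is_omega (M : structure) (w : M) : Prop :=
  limit_ord w /\ forall x : M, x ∈ w -> ~ limit_ord x.

Definition cardinal (M : structure) (k : M) : Prop :=
  Ord k /\ forall a : M, a ∈ k -> ~ exists f : M, bijection f a k.

Definition cofinal_map (M : structure) (f b a : M) : Prop :=
  maps_into f b a /\
  forall x : M, x ∈ a -> exists y z : M, y ∈ b /\ app f y z /\ ole x z.

(* [k = cf(a)] *)
Definition is_cf (M : structure) (a k : M) : Prop :=
  Ord k /\ (exists f : M, cofinal_map f k a) /\
  forall b : M, b ∈ k -> ~ exists f : M, cofinal_map f b a.

(* [i < cf(a)] *)
Definition lt_cf (M : structure) (i a : M) : Prop :=
  exists k : M, is_cf a k /\ i ∈ k.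

Definition same_cf (M : structure) (a b : M) : Prop :=
  exists k : M, is_cf a k /\ is_cf b k.

(* Infiniteness is needed: a finite cardinal [n > 1] has cofinality [1 < n]. *)
Definition singular_cardinal (M : structure) (m : M) : Prop :=
  cardinal m /\ (exists w : M, is_omega w /\ ole w m) /\
  (exists k : M, is_cf m k /\ k ∈ m).

(* [t = θ(A)] *)
Definition is_theta (M : structure) (A t : M) : Prop :=
  Ord t /\ ~ is_empty t /\ (~ exists f : M, onto f A t) /\
  forall b : M, b ∈ t -> ~ is_empty b -> exists f : M, onto f A b.

Record proper_filter (M : structure) (Y D : M) : Prop := {
  filter_subset : forall A : M, A ∈ D -> subset A Y;
  filter_full : Y ∈ D;
  filter_proper : forall A : M, A ∈ D -> ~ is_empty A;
  filter_upward : forall A B : M,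
    A ∈ D -> subset A B -> subset B Y -> B ∈ D;
  filter_inter : forall A B C : M,
    A ∈ D -> B ∈ D -> (forall x : M, x ∈ C <-> x ∈ A /\ x ∈ B) -> C ∈ D }.

(* [{s ∈ Y : R(f(s), g(s))} ∈ D] *)
Definition rel_mod (M : structure) (R : M -> M -> Prop) (Y D f g : M) : Prop :=
  exists A : M, A ∈ D /\
    forall s : M, s ∈ A <->
      s ∈ Y /\ exists a b : M, app f s a /\ app g s b /\ R a b.

Definition lt_mod (M : structure) (Y D f g : M) : Prop :=
  rel_mod (@mem M) Y D f g.

Definition le_mod (M : structure) (Y D f g : M) : Prop :=
  rel_mod (@ole M) Y D f g.

(* [f = g + 1] mod [D] *)
Definition succ_mod (M : structure) (Y D f g : M) : Prop :=
  rel_mod (fun a b => is_succ b a) Y D f g.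

(* [A] is a sequence indexed by [X] of pairwise disjoint, possibly empty,
   subsets of [Y] with union [Y]. *)
Definition partition (M : structure) (A X Y : M) : Prop :=
  maps A X (fun B => subset B Y) /\
  (forall s : M, s ∈ Y -> exists j B : M, app A j B /\ s ∈ B) /\
  (forall j j' B B' s : M,
     app A j B -> app A j' B' -> s ∈ B -> s ∈ B' -> j = j').

(* The data [𝔻], [d ↦ (Y_d, D_d)], [rk], [j], [μ] common to both kinds of
   systems.  The values of [rY], [rD], [rj] outside [𝔻], and of [rk d] outside
   the functions from [Y_d] to the ordinals, are irrelevant. *)
Record rank_data (M : structure) := RankData {
  rDD : M -> Prop;
  rY : M -> M;
  rD : M -> M;
  rk : M -> M -> M;
  rj : M -> M;
  rmu : M }.

Record rank1_data (M : structure) := Rank1Data {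
  base1 :> rank_data M;
  Sigma1 : M -> M -> Prop (* [Sigma1 d e] means [e ∈ Σ(d)] *) }.

Record rank2_data (M : structure) := Rank2Data {
  base2 :> rank_data M;
  Sigma2 : M -> M -> M -> Prop (* [Sigma2 d e h] means [(e,h) ∈ Σ(d)] *) }.

(* [f : Y_d → Ord] *)
Definition ord_fun (M : structure) (p : rank_data M) (d f : M) : Prop :=
  maps f (rY p d) (@Ord M).

Definition DD_ge (M : structure) (p : rank_data M) (i d : M) : Prop :=
  rDD p d /\ ole i (rj p d).

(* [rk_d(a) = b], where [a] stands for the constant function [a] on [Y_d] *)
Definition rk_const (M : structure) (p : rank_data M) (d a b : M) : Prop :=
  exists f : M, is_const f (rY p d) a /\ rk p d f = b.

(* The clauses that do not mention [Σ]. *)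
Record rank_common (M : structure) (p : rank_data M) : Prop := {
  rc_DD_definable : definable1 (rDD p);
  rc_Y_definable : definable2 (fun d y => rDD p d /\ y = rY p d);
  rc_D_definable : definable2 (fun d y => rDD p d /\ y = rD p d);
  rc_j_definable : definable2 (fun d y => rDD p d /\ y = rj p d);
  rc_rk_definable :
    definable3 (fun d f a => rDD p d /\ ord_fun p d f /\ a = rk p d f);
  rc_mu : singular_cardinal (rmu p);
  rc_filter : forall d : M, rDD p d -> proper_filter (rY p d) (rD p d);
  rc_theta : forall d : M, rDD p d ->
    exists t : M, is_theta (rY p d) t /\ t ∈ rmu p;
  rc_rk_ord : forall d f : M, rDD p d -> ord_fun p d f -> Ord (rk p d f);
  rc_j_lt : forall d : M, rDD p d -> lt_cf (rj p d) (rmu p);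
  rc_j_onto : forall i : M, lt_cf i (rmu p) ->
    exists d : M, rDD p d /\ rj p d = i;
  rc_rk_succ : forall d f g : M, rDD p d -> ord_fun p d f -> ord_fun p d g ->
    succ_mod (rY p d) (rD p d) f g -> is_succ (rk p d g) (rk p d f);
  rc_rk_mono : forall d f g : M, rDD p d -> ord_fun p d f -> ord_fun p d g ->
    le_mod (rY p d) (rD p d) f g -> ole (rk p d f) (rk p d g) }.

(* [d] is [(p, ≤ X)]-complete, for a 1-system. *)
Definition complete1 (M : structure) (p : rank1_data M) (X d : M) : Prop :=
  forall f A : M, ord_fun p d f -> partition A X (rY p d) ->
    exists e j B : M,
      Sigma1 p d e /\ j ∈ X /\ app A j B /\ B ∈ rD p e /\
      rk p e f = rk p d f.

Record weak_rank1_system (M : structure) (p : rank1_data M) : Prop := {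
  w1_common : rank_common p;
  w1_Sigma_definable : definable2 (fun d e => rDD p d /\ Sigma1 p d e);
  w1_Sigma : forall d e : M, rDD p d -> Sigma1 p d e ->
    rDD p e /\ rY p e = rY p d /\ ole (rj p d) (rj p e);
  w1_complete : forall sigma : M, sigma ∈ rmu p ->
    exists i : M, lt_cf i (rmu p) /\
      forall d : M, DD_ge p i d -> complete1 p sigma d;
  w1_no_hole : forall d f zeta : M, rDD p d -> ord_fun p d f ->
    zeta ∈ rk p d f ->
    exists e g : M, Sigma1 p d e /\ ord_fun p e g /\
      lt_mod (rY p e) (rD p e) g f /\ rk p e g = zeta }.

(* [d] is [(p, ≤ X)]-complete, for a 2-system; [C] is [h^-1(A_j)] and [k] is
   [f ∘ h]. *)
Definition complete2 (M : structure) (p : rank2_data M) (X d : M) : Prop :=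
  forall f A : M, ord_fun p d f -> partition A X (rY p d) ->
    exists e h j B C k : M,
      Sigma2 p d e h /\ j ∈ X /\ app A j B /\
      (forall t : M, t ∈ C <->
         t ∈ rY p e /\ exists s : M, app h t s /\ s ∈ B) /\
      C ∈ rD p e /\
      is_comp k f h /\ rk p e k = rk p d f.

Record weak_rank2_system (M : structure) (p : rank2_data M) : Prop := {
  w2_common : rank_common p;
  w2_Sigma_definable : definable3 (fun d e h => rDD p d /\ Sigma2 p d e h);
  w2_Sigma : forall d e h : M, rDD p d -> Sigma2 p d e h ->
    DD_ge p (rj p d) e /\ maps_into h (rY p e) (rY p d);
  w2_complete : forall sigma : M, sigma ∈ rmu p ->
    exists i : M, lt_cf i (rmu p) /\
      forall d : M, DD_ge p i d -> complete2 p sigma d;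
  w2_no_hole : forall d f zeta : M, rDD p d -> ord_fun p d f ->
    zeta ∈ rk p d f ->
    exists e h g k : M, Sigma2 p d e h /\ ord_fun p e g /\ is_comp k f h /\
      lt_mod (rY p e) (rD p e) g k /\ rk p e g = zeta }.

Definition strictness (M : structure) (p : rank_data M) : Prop :=
  forall d zeta xi f j0 : M,
    rDD p d -> Ord zeta -> Ord xi ->
    maps_into f (rY p d) xi -> rk p d f = zeta -> xi ∈ zeta ->
    same_cf zeta (rmu p) -> lt_cf j0 (rmu p) ->
    (forall s a d' : M, s ∈ rY p d -> app f s a -> DD_ge p j0 d' ->
       rk_const p d' a a) ->
    exists j : M, ole j0 j /\ lt_cf j (rmu p) /\
      ~ exists e g : M,
          DD_ge p j e /\ maps_into g (rY p e) zeta /\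
          (exists zeta' : M, zeta' ∈ zeta /\
             forall t b : M, t ∈ rY p e -> app g t b -> ole xi b /\ b ∈ zeta') /\
          ole zeta (rk p e g).

Definition strict_rank1_system (M : structure) (p : rank1_data M) : Prop :=
  weak_rank1_system p /\ strictness p.

Definition strict_rank2_system (M : structure) (p : rank2_data M) : Prop :=
  weak_rank2_system p /\ strictness p.

(* Main.v *)
From Stdlib Require Import Classical.
Require Import Defs.

(** Let [k = cf(μ)], and call an ordinal fixed from [i < k] when [rk_d] fixes it
    for all [d] with [j(d) >= i].  The claim is that every [zeta] is fixed from
    some stage, and it is proved by induction on [zeta].

    Ranks never lower a constant ([le_rk_const]), because successive constants
    have successive ranks.  So if [rk_d] moves [zeta], then the no-hole clause
    yields some [e] and some [g : Y_e -> zeta] with [rk_e(g) = zeta].  Such a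
    [g] can be taken bounded by some [x < zeta] ([bounded_fun_of_moved]).  If
    some ordinal [b < μ] maps cofinally into [zeta], the values of [g] are
    coloured by the first term of that sequence above them, and completeness
    makes the colour constant.  Otherwise the range of [g] is itself bounded:
    a cofinal range could be enumerated in fewer than [θ(Y_e) < μ] steps
    ([cofinal_below_theta]).

    By the induction hypothesis [zeta] is the increasing union over [i < k] of
    the sets [S_i] of the ordinals below [zeta] that are fixed from [i].

    - If some [S_i] is cofinal in [zeta] ([fixed_of_cofinal]), choose [y] in
      [S_i] above [x].  Monotonicity gives [zeta = rk_e(g) <= rk_e(y) = y < zeta]
      when [j(e) >= i], a contradiction, so [zeta] is not moved at late stages.

    - If every [S_i] is bounded ([fixed_of_bounded_stages]), then [zeta] is a
      limit with [cf(zeta) = k], by the regularity of [k].  Suppose that ranks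
      at arbitrarily late stages move [zeta].  Take [g] as above with values
      below some [xi < zeta], and colour the values by a stage from which they
      are fixed: completeness for [k < μ] provides [f] of rank [zeta], with
      values below [xi], all fixed from one [j0].  Strictness now gives [j]
      after which no function into an interval [[xi, zeta')] with
      [zeta' < zeta] has rank at least [zeta].  But a late stage moving [zeta]
      gives a bounded [g1] of rank [zeta], and [max(g1, xi)] is such a function.

    A 2-system may replace [f] by [f o h] on another set, and nothing relates
    the two filters.  What the argument needs of either kind of system is
    therefore phrased in terms of the values of [f] alone
    ([colour_completeness], [const_no_hole]), and properties that hold modulo a
    filter are first arranged to hold everywhere ([almost_everywhere]).

    There is no choice in the model, so all selections are of least ordinals
    ([choice_into_ord]).  Separation and replacement hold for definable classes
    only, which is why definability must be tracked for every class used. *)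

Set Implicit Arguments.
Unset Strict Implicit.

(** * Definable classes *)

Fixpoint rename (rho : nat -> nat) (phi : formula) : formula :=
  let up n := match n with O => O | S k => S (rho k) end in
  match phi with
  | FMem m n => FMem (rho m) (rho n)
  | FEq m n => FEq (rho m) (rho n)
  | FBot => FBot
  | FAnd a b => FAnd (rename rho a) (rename rho b)
  | FOr a b => FOr (rename rho a) (rename rho b)
  | FImp a b => FImp (rename rho a) (rename rho b)
  | FAll a => FAll (rename up a)
  | FEx a => FEx (rename up a)
  end.

Lemma sat_ext (M : structure) (phi : formula) (e e' : nat -> M) :
  (forall n, e n = e' n) -> (sat e phi <-> sat e' phi).
Proof.
  revert e e'; induction phi; intros e e' He; simpl; rewrite ?He; try tauto.
  1-3: specialize (IHphi1 _ _ He); specialize (IHphi2 _ _ He); tauto.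
  - split; intros H x; specialize (H x);
      (apply (IHphi (x .: e) (x .: e')); [intros [|n]; simpl; auto | exact H]).
  - split; intros [x H]; exists x;
      (apply (IHphi (x .: e) (x .: e')); [intros [|n]; simpl; auto | exact H]).
Qed.

Lemma sat_rename (M : structure) (phi : formula) (rho : nat -> nat) (e : nat -> M) :
  sat e (rename rho phi) <-> sat (fun n => e (rho n)) phi.
Proof.
  revert rho e; induction phi; intros rho e; simpl; try tauto.
  1-3: rewrite IHphi1, IHphi2; tauto.
  - split; intros H x; specialize (H x); rewrite IHphi in *;
      (eapply sat_ext; [|exact H]; intros [|n]; reflexivity).
  - split; intros [x H]; exists x; rewrite IHphi in *;
      (eapply sat_ext; [|exact H]; intros [|n]; reflexivity).
Qed.

Section Definability.
Variable M : structure.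

Definition value (e : nat -> M) (v : nat + M) : M :=
  match v with inl k => e k | inr c => c end.

(** Parameters are attached to the formula variables themselves: [r] sends each
    free variable either to a position of the environment or to a parameter, so
    that formulas with unrelated parameters can be combined. *)
Definition Def (P : (nat -> M) -> Prop) : Prop :=
  exists (phi : formula) (r : nat -> nat + M),
    forall e, P e <-> sat (fun n => value e (r n)) phi.

Definition is_term (a : (nat -> M) -> M) : Prop :=
  exists v, forall e, a e = value e v.

Lemma is_term_var k : is_term (fun e => e k).
Proof. exists (inl k); reflexivity. Qed.

Lemma is_term_const c : is_term (fun _ => c).
Proof. exists (inr c); reflexivity. Qed.

Lemma Def_mem a b : is_term a -> is_term b -> Def (fun e => a e ∈ b e).
Proof.
  intros [va Ha] [vb Hb].
  exists (FMem 0 1), (va .: fun _ => vb); intros e; simpl.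
  rewrite Ha, Hb; reflexivity.
Qed.

Lemma Def_eq a b : is_term a -> is_term b -> Def (fun e => a e = b e).
Proof.
  intros [va Ha] [vb Hb].
  exists (FEq 0 1), (va .: fun _ => vb); intros e; simpl.
  rewrite Ha, Hb; reflexivity.
Qed.

Lemma Def_False : Def (fun _ => False).
Proof. exists FBot, (fun n => inl n); simpl; tauto. Qed.

Fixpoint interleave (T : Type) (r1 r2 : nat -> T) (n : nat) : T :=
  match n with
  | O => r1 O
  | S O => r2 O
  | S (S k) => interleave (fun n => r1 (S n)) (fun n => r2 (S n)) k
  end.

Lemma interleave_even (T : Type) (r1 r2 : nat -> T) n :
  interleave r1 r2 (n + n) = r1 n.
Proof.
  revert r1 r2; induction n; intros; simpl; [reflexivity|].
  rewrite <- plus_n_Sm; simpl; apply (IHn (fun n => r1 (S n))).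
Qed.

Lemma interleave_odd (T : Type) (r1 r2 : nat -> T) n :
  interleave r1 r2 (S (n + n)) = r2 n.
Proof.
  revert r1 r2; induction n; intros; simpl; [reflexivity|].
  rewrite <- plus_n_Sm; apply (IHn (fun n => r1 (S n)) (fun n => r2 (S n))).
Qed.

Lemma Def_joint P Q : Def P -> Def Q ->
  exists phi psi r, forall e,
    (P e <-> sat (fun n => value e (r n)) phi) /\
    (Q e <-> sat (fun n => value e (r n)) psi).
Proof.
  intros [phi [r1 HP]] [psi [r2 HQ]].
  exists (rename (fun n => n + n) phi), (rename (fun n => S (n + n)) psi),
    (interleave r1 r2).
  intros e; rewrite !sat_rename, HP, HQ.
  split; apply sat_ext; intros n.
  - rewrite interleave_even; reflexivity.
  - rewrite interleave_odd; reflexivity.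
Qed.

Lemma Def_and P Q : Def P -> Def Q -> Def (fun e => P e /\ Q e).
Proof.
  intros HP HQ; destruct (Def_joint HP HQ) as [phi [psi [r H]]].
  exists (FAnd phi psi), r; intros e; simpl; destruct (H e); tauto.
Qed.

Lemma Def_or P Q : Def P -> Def Q -> Def (fun e => P e \/ Q e).
Proof.
  intros HP HQ; destruct (Def_joint HP HQ) as [phi [psi [r H]]].
  exists (FOr phi psi), r; intros e; simpl; destruct (H e); tauto.
Qed.

Lemma Def_imp P Q : Def P -> Def Q -> Def (fun e => P e -> Q e).
Proof.
  intros HP HQ; destruct (Def_joint HP HQ) as [phi [psi [r H]]].
  exists (FImp phi psi), r; intros e; simpl; destruct (H e); tauto.
Qed.

Lemma Def_equiv P Q : Def P -> Def Q -> Def (fun e => P e <-> Q e).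
Proof. intros; apply Def_and; apply Def_imp; assumption. Qed.

Lemma Def_not P : Def P -> Def (fun e => ~ P e).
Proof. intros; apply Def_imp; [assumption|apply Def_False]. Qed.

(** Position [0] of the environment becomes the bound variable.  Formula
    variables assigned to other positions or to parameters are moved out of
    its way. *)
Lemma Def_bind (P : (nat -> M) -> M -> Prop) :
  Def (fun e => P (fun n => e (S n)) (e 0)) ->
  exists phi r, forall e x, P e x <-> sat (x .: fun n => value e (r n)) phi.
Proof.
  intros [phi [r H]].
  exists (rename (fun n => match r n with inl 0 => 0 | _ => S n end) phi),
    (fun n => match r n with inl (S k) => inl k | v => v end).
  intros e x; rewrite sat_rename.
  specialize (H (x .: e)); simpl in H.
  etransitivity; [exact H|].
  apply sat_ext; intros n.
  destruct (r n) as [[|k]|c] eqn:E; simpl; rewrite ?E; reflexivity.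
Qed.

Lemma Def_all (P : (nat -> M) -> M -> Prop) :
  Def (fun e => P (fun n => e (S n)) (e 0)) -> Def (fun e => forall x, P e x).
Proof.
  intros H; destruct (Def_bind H) as [phi [r H']].
  exists (FAll phi), r; intros e; simpl.
  split; intros G x; apply H', G.
Qed.

Lemma Def_ex (P : (nat -> M) -> M -> Prop) :
  Def (fun e => P (fun n => e (S n)) (e 0)) -> Def (fun e => exists x, P e x).
Proof.
  intros H; destruct (Def_bind H) as [phi [r H']].
  exists (FEx phi), r; intros e; simpl.
  split; intros [x G]; exists x; apply H', G.
Qed.

Lemma Def_app1 (P : M -> Prop) a :
  definable1 P -> is_term a -> Def (fun e => P (a e)).
Proof.
  intros [phi [e0 H]] [va Ha].
  exists phi, (va .: fun n => inr (e0 n)); intros e; rewrite H, Ha.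
  apply sat_ext; intros [|n]; reflexivity.
Qed.

Lemma Def_app2 (P : M -> M -> Prop) a b :
  definable2 P -> is_term a -> is_term b -> Def (fun e => P (a e) (b e)).
Proof.
  intros [phi [e0 H]] [va Ha] [vb Hb].
  exists phi, (va .: vb .: fun n => inr (e0 n)); intros e; rewrite H, Ha, Hb.
  apply sat_ext; intros [|[|n]]; reflexivity.
Qed.

Lemma Def_app3 (P : M -> M -> M -> Prop) a b c :
  definable3 P -> is_term a -> is_term b -> is_term c ->
  Def (fun e => P (a e) (b e) (c e)).
Proof.
  intros [phi [e0 H]] [va Ha] [vb Hb] [vc Hc].
  exists phi, (va .: vb .: vc .: fun n => inr (e0 n)).
  intros e; rewrite H, Ha, Hb, Hc.
  apply sat_ext; intros [|[|[|n]]]; reflexivity.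
Qed.

Lemma definable1_Def (m : M) (P : M -> Prop) :
  Def (fun e => P (e 0)) -> definable1 P.
Proof.
  intros H; destruct (@Def_bind (fun _ x => P x) H) as [phi [r G]].
  exists phi, (fun n => value (fun _ => m) (r n)); intros x; apply G.
Qed.

Lemma definable2_Def (m : M) (P : M -> M -> Prop) :
  Def (fun e => P (e 0) (e 1)) -> definable2 P.
Proof.
  intros [phi [r H]].
  exists (rename (fun n => match r n with inl 0 => 0 | inl (S 0) => 1
                           | _ => S (S n) end) phi),
    (fun n => match r n with inl _ => m | inr c => c end).
  intros x y; rewrite sat_rename.
  specialize (H (x .: y .: fun _ => m)); simpl in H.
  etransitivity; [exact H|].
  apply sat_ext; intros n.
  destruct (r n) as [[|[|k]]|c] eqn:E; simpl; rewrite ?E; reflexivity.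
Qed.

End Definability.

(** Proves definability by following the shape of the predicate.  Hypotheses come
    before the splitting of conjunctions because the graphs of [rj], [rY] and
    [rk] are definable only together with the condition on their domain. *)
Ltac term := first [apply is_term_var | apply is_term_const].
Ltac def_hyp :=
  match goal with
  | H : definable1 ?P |- _ => apply (Def_app1 H); term
  | H : definable2 ?P |- _ => apply (Def_app2 H); term
  | H : definable3 ?P |- _ => apply (Def_app3 H); term
  end.
Ltac def_step :=
  cbv beta;
  lazymatch goal with
  | |- Def (fun e => _ /\ _) => first [def_hyp | apply Def_and]
  | |- Def (fun e => _ \/ _) => apply Def_or
  | |- Def (fun e => _ <-> _) => apply Def_equiv
  | |- Def (fun e => ~ _) => apply Def_not
  | |- Def (fun e => False) => apply Def_False
  | |- Def (fun e => exists x, _) => apply Def_ex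
  | |- Def (fun e => _ ∈ _) => apply Def_mem; term
  | |- Def (fun e => _ = _) => apply Def_eq; term
  | |- Def _ =>
      first
      [ def_hyp
      | apply Def_imp
      | apply Def_all
      | progress unfold onto, is_const, cofinal_map, maps_into, maps, app,
          is_opair, is_upair, Ord, ole, is_succ, is_empty, subset, unique ]
  end.
Ltac def :=
  lazymatch goal with
  | |- @definable1 ?M _ =>
      eapply definable1_Def; [first [assumption | eassumption]|]
  | |- @definable2 ?M _ =>
      eapply definable2_Def; [first [assumption | eassumption]|]
  | |- _ => idtac
  end; repeat def_step.


Section Sets.
Variable M : structure.
Hypothesis ZM : ZF M.

(** * Functions and ordinals in a model of ZF *)

Lemma separation (P : M -> Prop) (a : M) :
  definable1 P -> exists b, forall z, z ∈ b <-> z ∈ a /\ P z.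
Proof.
  intros [phi [e H]].
  destruct (ZF_separation ZM phi e a) as [b Hb].
  exists b; intros z; rewrite Hb, H; tauto.
Qed.

Lemma replacement (R : M -> M -> Prop) (a : M) :
  definable2 R ->
  (forall x y y', x ∈ a -> R x y -> R x y' -> y = y') ->
  exists b, forall y, y ∈ b <-> exists x, x ∈ a /\ R x y.
Proof.
  intros [phi [e H]] HR.
  destruct (@ZF_replacement M ZM phi e a) as [b Hb].
  - intros x y y' Hx; rewrite <- !H; apply HR; assumption.
  - exists b; intros y; rewrite Hb.
    split; intros [x Hx]; exists x; [rewrite H|rewrite <- H]; assumption.
Qed.

Lemma upair_uniq p q a b : is_upair (M := M) p a b -> is_upair q a b -> p = q.
Proof.
  intros Hp Hq; apply (ZF_extensionality ZM); intros z.
  rewrite (Hp z), (Hq z); reflexivity.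
Qed.

Lemma opair_uniq p q a b : is_opair (M := M) p a b -> is_opair q a b -> p = q.
Proof.
  intros [u [v [Hu [Hv Hp]]]] [u' [v' [Hu' [Hv' Hq]]]].
  rewrite (upair_uniq Hu' Hu), (upair_uniq Hv' Hv) in Hq.
  apply (upair_uniq Hp Hq).
Qed.

Lemma opair_ex a b : exists p : M, is_opair p a b.
Proof.
  destruct (ZF_pairing ZM a a) as [u Hu], (ZF_pairing ZM a b) as [v Hv].
  destruct (ZF_pairing ZM u v) as [p Hp].
  exists p, u, v; auto.
Qed.

Lemma opair_inj p a b c d :
  is_opair (M := M) p a b -> is_opair p c d -> a = c /\ b = d.
Proof.
  intros [u [v [Hu [Hv Hp]]]] [u' [v' [Hu' [Hv' Hp']]]].
  assert (Eac : a = c).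
  { assert (H : u' ∈ p) by (apply Hp'; auto).
    assert (H' : a ∈ u').
    { apply Hp in H; destruct H as [-> | ->]; [apply Hu | apply Hv]; auto. }
    apply Hu' in H'; tauto. }
  subst c; split; [reflexivity|].
  rewrite (upair_uniq Hu' Hu) in Hp'.
  assert (H1 : v = u \/ v = v') by (apply Hp', Hp; auto).
  assert (H2 : v' = u \/ v' = v) by (apply Hp, Hp'; auto).
  assert (Hb : b ∈ v) by (apply Hv; auto).
  assert (Hd : d ∈ v') by (apply Hv'; auto).
  destruct H1 as [-> | ->].
  - apply Hu in Hb; destruct H2 as [-> | ->]; apply Hu in Hd;
      destruct Hb, Hd; congruence.
  - apply Hv' in Hb; apply Hv in Hd; destruct Hb, Hd; congruence.
Qed.

Lemma maps_dom f A (B : M -> Prop) x y : maps f A B -> app f x y -> x ∈ A /\ B y.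
Proof.
  intros [H _] [p [Hp Hpf]]; destruct (H p Hpf) as [x' [y' [Hp' Hx]]].
  destruct (opair_inj Hp Hp') as [-> ->]; exact Hx.
Qed.

Lemma maps_fun f A (B : M -> Prop) x y y' :
  maps f A B -> app f x y -> app f x y' -> y = y'.
Proof.
  intros Hf H H'; destruct (proj2 Hf x (proj1 (maps_dom Hf H))) as [v [_ Hv]].
  rewrite <- (Hv y H); apply Hv, H'.
Qed.

Lemma maps_tot f A (B : M -> Prop) x :
  maps f A B -> x ∈ A -> exists y, app f x y /\ B y.
Proof.
  intros Hf Hx; destruct (proj2 Hf x Hx) as [y [Hy _]].
  exists y; split; [exact Hy | apply (maps_dom Hf Hy)].
Qed.

Lemma maps_weaken f A (B C : M -> Prop) :
  maps f A B -> (forall x y, app f x y -> C y) -> maps f A C.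
Proof.
  intros [H1 H2] HC; split; [|exact H2].
  intros p Hp; destruct (H1 p Hp) as [x [y [Hxy [Hx _]]]].
  exists x, y; repeat split; auto; apply (HC x); exists p; auto.
Qed.

Lemma function_ex (R : M -> M -> Prop) (A : M) :
  definable2 R -> (forall x, x ∈ A -> exists! y, R x y) ->
  exists f, maps f A (fun _ => True) /\
    forall x y, app f x y <-> x ∈ A /\ R x y.
Proof.
  intros HR Htot.
  destruct (@replacement (fun x p => exists y, R x y /\ is_opair p x y) A)
    as [f Hf]; [def| |].
  { intros x p p' Hx [y [Hy Hp]] [y' [Hy' Hp']].
    destruct (Htot x Hx) as [v [_ Hv]].
    rewrite <- (Hv y Hy) in Hp; rewrite <- (Hv y' Hy') in Hp'.
    exact (opair_uniq Hp Hp'). }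
  assert (Happ : forall x y, app f x y <-> x ∈ A /\ R x y).
  { intros x y; split.
    - intros [p [Hp Hpf]]; apply Hf in Hpf.
      destruct Hpf as [x' [Hx' [y' [Hy' Hp']]]].
      destruct (opair_inj Hp Hp') as [-> ->]; auto.
    - intros [Hx Hy]; destruct (opair_ex x y) as [p Hp].
      exists p; split; [exact Hp|]; apply Hf; eauto. }
  exists f; split; [split|exact Happ].
  - intros p Hp; apply Hf in Hp; destruct Hp as [x [Hx [y [Hy Hp]]]].
    exists x, y; auto.
  - intros x Hx; destruct (Htot x Hx) as [y [Hy Hu]].
    exists y; split; [apply Happ; auto|].
    intros y' Hy'; apply Hu, (Happ x y'), Hy'.
Qed.

Lemma mem_asym (x y : M) : x ∈ y -> ~ y ∈ x.
Proof.
  intros Hxy Hyx; destruct (ZF_pairing ZM x y) as [p Hp].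
  destruct (ZF_foundation ZM (x := p)) as [m [Hm H]].
  { intros E; apply (E x), Hp; auto. }
  apply Hp in Hm; destruct Hm as [-> | ->].
  - apply (H y Hyx), Hp; auto.
  - apply (H x Hxy), Hp; auto.
Qed.

Lemma mem_irrefl (x : M) : ~ x ∈ x.
Proof. intros H; exact (mem_asym H H). Qed.

Lemma ord_trans (a b c : M) : Ord c -> a ∈ b -> b ∈ c -> a ∈ c.
Proof. intros [H _] Hab Hbc; exact (H b Hbc a Hab). Qed.

Lemma ord_mem (a b : M) : Ord a -> b ∈ a -> Ord b.
Proof.
  intros Ha Hb; split.
  - intros x Hx z Hz.
    assert (Hxa := ord_trans Ha Hx Hb); assert (Hza := ord_trans Ha Hz Hxa).
    destruct (proj2 Ha z b Hza Hb) as [H | [-> | H]]; [exact H| |].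
    + destruct (mem_asym Hx Hz).
    + (* foundation forbids the cycle b ∈ z ∈ x ∈ b *)
      destruct (@separation (fun w => w = x \/ w = z \/ w = b) a) as [p Hp]; [def|].
      destruct (ZF_foundation ZM (x := p)) as [m [Hm Hmin]].
      { intros E; apply (E x), Hp; auto. }
      apply Hp in Hm; destruct Hm as [_ [-> | [-> | ->]]].
      * destruct (Hmin z Hz); apply Hp; auto.
      * destruct (Hmin b H); apply Hp; auto.
      * destruct (Hmin x Hx); apply Hp; auto.
  - intros x y Hx Hy; apply (proj2 Ha); eapply ord_trans; eauto.
Qed.

Lemma ord_subset (a b : M) : Ord a -> Ord b -> subset a b -> a = b \/ a ∈ b.
Proof.
  intros Ha Hb Hab.
  destruct (classic (a = b)) as [E|N]; [auto|right].
  destruct (@separation (fun w => ~ w ∈ a) b) as [p Hp]; [def|].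
  destruct (ZF_foundation ZM (x := p)) as [m [Hm Hmin]].
  { intros E; apply N, (ZF_extensionality ZM); intros z; split; [apply Hab|].
    intros Hz; apply NNPP; intros H; apply (E z), Hp; auto. }
  apply Hp in Hm; destruct Hm as [Hmb Hma].
  replace a with m; [exact Hmb|]; apply (ZF_extensionality ZM); intros z; split.
  - intros Hz; apply NNPP; intros H; apply (Hmin z Hz), Hp; split; [|exact H].
    exact (ord_trans Hb Hz Hmb).
  - intros Hz; destruct (proj2 Hb z m (Hab z Hz) Hmb) as [H | [-> | H]];
      [exact H|tauto|].
    destruct (Hma (ord_trans Ha H Hz)).
Qed.

Lemma ord_tricho (a b : M) : Ord a -> Ord b -> a ∈ b \/ a = b \/ b ∈ a.
Proof.
  intros Ha Hb.
  destruct (@separation (fun w => w ∈ b) a) as [c Hc]; [def|].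
  assert (Oc : Ord c).
  { split.
    - intros y Hy z Hz; apply Hc in Hy; destruct Hy as [Hya Hyb].
      apply Hc; split; eapply ord_trans; eauto.
    - intros y z Hy Hz; apply Hc in Hy, Hz; apply (proj2 Ha); tauto. }
  destruct (ord_subset Oc Ha) as [-> | H]; [intros z Hz; apply Hc in Hz; tauto| |].
  { destruct (ord_subset Ha Hb); auto; intros z Hz; apply Hc in Hz; tauto. }
  destruct (ord_subset Oc Hb) as [-> | H']; [intros z Hz; apply Hc in Hz; tauto|auto|].
  destruct (@mem_irrefl c); apply Hc; auto.
Qed.

Lemma ole_refl (a : M) : ole a a.
Proof. right; reflexivity. Qed.

Lemma ole_mem_trans (a b c : M) : Ord c -> ole a b -> b ∈ c -> a ∈ c.
Proof. intros Hc [H | ->] H'; [eapply ord_trans; eauto|exact H']. Qed.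

Lemma mem_ole_trans (a b c : M) : Ord c -> a ∈ b -> ole b c -> a ∈ c.
Proof. intros Hc H [H' | ->]; [eapply ord_trans; eauto|exact H]. Qed.

Lemma ole_trans (a b c : M) : Ord c -> ole a b -> ole b c -> ole a c.
Proof.
  intros Hc [H | ->] H'; [left; eapply mem_ole_trans; eauto|exact H'].
Qed.

Lemma ole_not_mem (a b : M) : ole a b -> ~ b ∈ a.
Proof. intros [H | ->]; [exact (mem_asym H)|apply mem_irrefl]. Qed.

Lemma ole_or_mem (a b : M) : Ord a -> Ord b -> ole a b \/ b ∈ a.
Proof. intros Ha Hb; destruct (ord_tricho Ha Hb) as [|[|]]; unfold ole; auto. Qed.

Lemma max_ex (a b : M) :
  Ord a -> Ord b -> exists c, (c = a \/ c = b) /\ ole a c /\ ole b c.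
Proof.
  intros Ha Hb; destruct (ole_or_mem Ha Hb) as [H|H].
  - exists b; auto using ole_refl.
  - exists a; unfold ole; auto.
Qed.

Lemma succ_ex (a : M) : Ord a -> exists b, is_succ a b /\ Ord b.
Proof.
  intros Ha; destruct (ZF_pairing ZM a a) as [s Hs].
  destruct (ZF_pairing ZM a s) as [p Hp], (ZF_union ZM p) as [b Hb].
  assert (H : is_succ a b).
  { intros z; rewrite Hb; split.
    - intros [y [Hy Hz]]; apply Hp in Hy; destruct Hy as [-> | ->]; [auto|].
      apply Hs in Hz; tauto.
    - intros [Hz | ->]; [exists a|exists s]; (split; [apply Hp; auto|]); auto.
      apply Hs; auto. }
  exists b; split; [exact H|split].
  - intros y Hy z Hz; apply H; left.
    apply H in Hy; exact (mem_ole_trans Ha Hz Hy).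
  - intros y z Hy Hz; apply H in Hy, Hz.
    apply ord_tricho; [destruct Hy as [Hy | ->]|destruct Hz as [Hz | ->]];
      eauto using ord_mem.
Qed.

Lemma least_ord (P : M -> Prop) (a : M) :
  definable1 P -> Ord a -> P a ->
  exists b, Ord b /\ P b /\ ole b a /\ forall c, c ∈ b -> ~ P c.
Proof.
  intros HP Ha Pa; destruct (succ_ex Ha) as [a' [Hs Ha']].
  destruct (separation a' HP) as [p Hp].
  destruct (ZF_foundation ZM (x := p)) as [m [Hm Hmin]].
  { intros E; apply (E a), Hp; split; [apply Hs; auto|exact Pa]. }
  apply Hp in Hm; destruct Hm as [Hma Hm].
  exists m; repeat split; [apply (ord_mem Ha' Hma)|apply (ord_mem Ha' Hma)|exact Hm| |].
  - apply Hs, Hma.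
  - intros c Hc H; apply (Hmin c Hc), Hp; split; [|exact H].
    exact (ord_trans Ha' Hc Hma).
Qed.

Lemma least_ord_uniq (P : M -> Prop) (a b : M) :
  Ord a -> Ord b -> P a -> P b ->
  (forall c, c ∈ a -> ~ P c) -> (forall c, c ∈ b -> ~ P c) -> a = b.
Proof.
  intros Ha Hb Pa Pb La Lb.
  destruct (ord_tricho Ha Hb) as [H|[H|H]]; [|exact H|].
  - destruct (Lb a H Pa).
  - destruct (La b H Pb).
Qed.

Lemma ord_induction (P : M -> Prop) :
  definable1 P ->
  (forall a, Ord a -> (forall c, c ∈ a -> P c) -> P a) ->
  forall a, Ord a -> P a.
Proof.
  intros HP IH a Ha; apply NNPP; intros N.
  destruct (@least_ord (fun a => ~ P a) a) as [b [Hb [Nb [_ Lb]]]]; [def|auto..|].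
  apply Nb, IH; [exact Hb|]; intros c Hc; apply NNPP; exact (Lb c Hc).
Qed.

(** Choice functions into an ordinal are free in ZF: take least witnesses. *)
Lemma choice_into_ord (R : M -> M -> Prop) (A B : M) :
  definable2 R -> Ord B ->
  (forall x, x ∈ A -> exists y, y ∈ B /\ R x y) ->
  exists f, maps_into f A B /\ forall x y, app f x y -> R x y.
Proof.
  intros HR HB Htot.
  destruct (@function_ex
    (fun x y => (y ∈ B /\ R x y) /\ forall z, z ∈ y -> ~ (z ∈ B /\ R x z)) A)
    as [f [Hf Happ]]; [def| |].
  { intros x Hx; destruct (Htot x Hx) as [y [Hy Hxy]].
    destruct (@least_ord (fun y => y ∈ B /\ R x y) y)
      as [z [Oz [Pz [_ Lz]]]]; [def|exact (ord_mem HB Hy)|auto|].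
    exists z; split; [auto|].
    intros z' [Pz' Lz']; apply (least_ord_uniq (P := fun y => y ∈ B /\ R x y));
      auto; apply (ord_mem HB); tauto. }
  exists f; split; [|intros x y Hxy; apply Happ in Hxy; tauto].
  apply (maps_weaken Hf); intros x y Hxy; apply Happ in Hxy; tauto.
Qed.

(** * Cofinalities and surjections *)

Lemma cf_uniq (a k k' : M) : is_cf a k -> is_cf a k' -> k = k'.
Proof.
  intros [Hk [Ek Lk]] [Hk' [Ek' Lk']].
  destruct (ord_tricho Hk Hk') as [H|[H|H]]; [|exact H|].
  - destruct (Lk' k H Ek).
  - destruct (Lk k' H Ek').
Qed.

Lemma cofinal_map_of_rel (R : M -> M -> Prop) (b a : M) :
  definable2 R -> Ord a ->
  (forall z, z ∈ b -> exists y, y ∈ a /\ R z y) ->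
  (forall x, x ∈ a -> exists z, z ∈ b /\ forall y, y ∈ a -> R z y -> ole x y) ->
  exists f, cofinal_map f b a.
Proof.
  intros HR Ha Htot Hcof.
  destruct (choice_into_ord HR Ha Htot) as [f [Hf HfR]].
  exists f; split; [exact Hf|]; intros x Hx.
  destruct (Hcof x Hx) as [z [Hz H]], (maps_tot Hf Hz) as [y [Hy Hya]].
  exists z, y; auto.
Qed.

(** A cofinality is regular: were the indices chosen from [U] unbounded in
    [k = cf(a)], the map sending [z] to a bound in [a] of the part of a cofinal
    [k]-sequence below the index of [z] would be cofinal of length [b < k]. *)
Lemma cf_regular (a k b : M) (U : M -> M -> Prop) :
  Ord a -> is_cf a k -> b ∈ k -> definable2 U ->
  (forall z, z ∈ b -> exists i, i ∈ k /\ U z i) ->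
  exists w, w ∈ k /\ forall z, z ∈ b -> exists i, i ∈ k /\ ole i w /\ U z i.
Proof.
  intros Ha [Hk [[f [Hf Hcof]] Hmin]] Hb HU Htot.
  apply NNPP; intros N; apply (Hmin b Hb).
  apply (@cofinal_map_of_rel (fun z y => exists i, i ∈ k /\ U z i /\
    forall v x, v ∈ i -> app f v x -> x ∈ y)); [def|exact Ha| |].
  - intros z Hz; destruct (Htot z Hz) as [i [Hi Ui]].
    apply NNPP; intros N'; apply (Hmin i Hi).
    apply (@cofinal_map_of_rel (fun v x => app f v x)); [def|exact Ha| |].
    + intros v Hv; destruct (maps_tot Hf (ord_trans Hk Hv Hi)) as [x Hx].
      exists x; tauto.
    + intros y Hy; apply NNPP; intros N''; apply N'.
      exists y; split; [exact Hy|]; exists i; repeat split; auto.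
      intros v x Hv Hx; apply NNPP; intros N3; apply N''.
      exists v; split; [exact Hv|]; intros x' Hx' Hfx'.
      rewrite (maps_fun Hf Hfx' Hx).
      destruct (@ole_or_mem y x) as [H|H]; [|exact (ord_mem Ha (proj2 (maps_dom Hf Hx)))|exact H|tauto].
      exact (ord_mem Ha Hy).
  - intros x Hx; destruct (Hcof x Hx) as [w [fw [Hw [Hfw Hle]]]].
    assert (H : exists z, z ∈ b /\ forall i, i ∈ k -> U z i -> w ∈ i).
    { apply NNPP; intros N'; apply N; exists w; split; [exact Hw|].
      intros z Hz; apply NNPP; intros N''; apply N'; exists z; split; [exact Hz|].
      intros i Hi Ui; apply NNPP; intros N3; apply N''; exists i.
      destruct (@ole_or_mem i w); eauto using ord_mem; tauto. }
    destruct H as [z [Hz Hzi]]; exists z; split; [exact Hz|].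
    intros y Hy [i [Hi [Ui Hy']]]; left.
    exact (ole_mem_trans (ord_mem Ha Hy) Hle (Hy' w fw (Hzi i Hi Ui) Hfw)).
Qed.

Section Enumeration.
Variables g Y zeta : M.
Hypothesis Hg : maps_into g Y zeta.
Hypothesis Hzeta : Ord zeta.

Let range v := exists s, app g s v.

(** The recursion step of the increasing enumeration of the range of [g].  It
    looks at [q] below [c] only, so that enumerations can be compared and
    extended without a recursion theorem. *)
Definition next (q c v : M) : Prop :=
  range v /\ (forall d, d ∈ c -> ~ app q d v) /\
  forall w, w ∈ v -> range w -> exists d, d ∈ c /\ app q d w.

Definition enumeration (q b : M) : Prop :=
  maps_into q b zeta /\ forall c v, app q c v -> next q c v.

Lemma range_ord v : range v -> Ord v.
Proof. intros [s Hs]; exact (ord_mem Hzeta (proj2 (maps_dom Hg Hs))). Qed.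

Lemma next_uniq q q' c v v' :
  (forall d, d ∈ c -> forall x, app q d x <-> app q' d x) ->
  next q c v -> next q' c v' -> v = v'.
Proof.
  intros E [Rv [Nv Lv]] [Rv' [Nv' Lv']].
  apply (@least_ord_uniq (fun v => range v /\ forall d, d ∈ c -> ~ app q d v));
    auto using range_ord.
  - split; [exact Rv'|]; intros d Hd H; apply (Nv' d Hd), (E d Hd), H.
  - intros w Hw [Rw Nw]; destruct (Lv w Hw Rw) as [d [Hd H]]; exact (Nw d Hd H).
  - intros w Hw [Rw Nw]; destruct (Lv' w Hw Rw) as [d [Hd H]].
    apply (Nw d Hd), (E d Hd), H.
Qed.

Lemma enumeration_agree q q' b b' :
  Ord b -> Ord b' -> enumeration q b -> enumeration q' b' ->
  forall c, Ord c -> c ∈ b -> c ∈ b' -> forall x, app q c x <-> app q' c x.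
Proof.
  intros Hb Hb' [Hq Nq] [Hq' Nq'].
  apply (@ord_induction (fun c => c ∈ b -> c ∈ b' ->
    forall x, app q c x <-> app q' c x)); [def|].
  intros c Hc IH Hcb Hcb' x.
  destruct (maps_tot Hq Hcb) as [v [Hv _]], (maps_tot Hq' Hcb') as [v' [Hv' _]].
  assert (E : v = v').
  { apply (@next_uniq q q' c); auto.
    intros d Hd; apply IH; eauto using ord_trans. }
  subst v'; split; intros H.
  - rewrite (maps_fun Hq H Hv); exact Hv'.
  - rewrite (maps_fun Hq' H Hv'); exact Hv.
Qed.

(** Enumerations exist at all stages, unless the range is exhausted at an
    earlier one: the [next] values of the shorter enumerations, which agree
    with one another, make up the enumeration of length [b]. *)
Lemma enumeration_ex b :
  Ord b ->
  (forall c, c ∈ b -> exists q, enumeration q c) ->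
  (exists q, enumeration q b) \/
  (exists c q, c ∈ b /\ enumeration q c /\
     forall v, range v -> exists d, d ∈ c /\ app q d v).
Proof.
  intros Hb Hex.
  destruct (classic (exists c q, c ∈ b /\ enumeration q c /\
     forall v, range v -> exists d, d ∈ c /\ app q d v)) as [H|N]; [auto|left].
  destruct (@choice_into_ord (fun c v => exists q, enumeration q c /\ next q c v)
    b zeta) as [f [Hf Hfn]];
    [unfold enumeration, next, range; def|exact Hzeta| |].
  { intros c Hc; destruct (Hex c Hc) as [q Hq].
    assert (H : exists v, range v /\ forall d, d ∈ c -> ~ app q d v).
    { apply NNPP; intros N'; apply N; exists c, q; split; [exact Hc|split; [exact Hq|]].
      intros v Rv; apply NNPP; intros N''; apply N'; exists v; split; [exact Rv|].
      intros d Hd H; apply N''; eauto. }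
    destruct H as [v0 Hv0].
    destruct (@least_ord (fun v => range v /\ forall d, d ∈ c -> ~ app q d v) v0)
      as [v [Ov [Pv [_ Lv]]]];
      [unfold range; def|exact (range_ord (proj1 Hv0))|exact Hv0|].
    exists v; split; [destruct Pv as [[s Hs] _]; exact (proj2 (maps_dom Hg Hs))|].
    exists q; split; [exact Hq|].
    split; [tauto|]; split; [tauto|]; intros w Hw Rw.
    apply NNPP; intros N'; apply (Lv w Hw); split; [exact Rw|].
    intros d Hd H; apply N'; eauto. }
  assert (E : forall c q, c ∈ b -> enumeration q c ->
    forall d, d ∈ c -> forall x, app q d x <-> app f d x).
  { intros c q Hc Hq d Hd x.
    assert (Oc := ord_mem Hb Hc); assert (Od := ord_mem Oc Hd).
    assert (Hdb := ord_trans Hb Hd Hc).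
    destruct (maps_tot Hf Hdb) as [v [Hv _]], (maps_tot (proj1 Hq) Hd) as [u [Hu _]].
    destruct (Hfn d v Hv) as [q' [Hq' Nv]].
    assert (u = v).
    { apply (@next_uniq q q' d); [|apply Hq; exact Hu|exact Nv].
      intros d' Hd'; apply (enumeration_agree Oc Od Hq Hq');
        eauto using ord_trans, ord_mem. }
    subst v; split; intros H.
    - rewrite (maps_fun (proj1 Hq) H Hu); exact Hv.
    - rewrite (maps_fun Hf H Hv); exact Hu. }
  exists f; split; [exact Hf|].
  intros c v Hcv; assert (Hc := proj1 (maps_dom Hf Hcv)).
  destruct (Hfn c v Hcv) as [q [Hq [Rv [Nv Lv]]]].
  split; [exact Rv|]; split.
  - intros d Hd H; apply (Nv d Hd), (E c q Hc Hq d Hd), H.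
  - intros w Hw Rw; destruct (Lv w Hw Rw) as [d [Hd H]].
    exists d; split; [exact Hd|]; apply (E c q Hc Hq d Hd), H.
Qed.

(** Enumerating the range without repetition must stop before stage
    [t = θ(Y)], since an enumeration of length [t] would invert to a function
    from [Y] onto [t].  The stage at which it stops is the length of a cofinal
    sequence in [zeta]. *)
Lemma cofinal_below_theta t :
  is_theta Y t ->
  (forall x, x ∈ zeta -> exists s a, app g s a /\ ole x a) ->
  exists b c, b ∈ t /\ cofinal_map c b zeta.
Proof.
  intros [Ht [Hne [Hno _]]] Hcof.
  assert (H : exists c q, ole c t /\ Ord c /\ enumeration q c /\
    (c = t \/ forall v, range v -> exists d, d ∈ c /\ app q d v)).
  { destruct (classic (exists q, enumeration q t)) as [[q Hq]|N].
    - exists t, q; auto using ole_refl.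
    - destruct (@least_ord (fun b => ~ exists q, enumeration q b) t)
        as [b [Hb [Nb [Hbt Lb]]]];
        [unfold enumeration, next, range; def|exact Ht|exact N|].
      destruct (enumeration_ex Hb) as [H|[c [q [Hc [Hq H]]]]];
        [intros c Hc; apply NNPP, (Lb c Hc)|tauto|].
      exists c, q; split; [left; exact (mem_ole_trans Ht Hc Hbt)|].
      eauto using ord_mem. }
  destruct H as [c [q [Hct [Hc [Hq H]]]]].
  assert (Hlt : c ∈ t).
  { destruct Hct as [Hct | ->]; [exact Hct|exfalso; apply Hno].
    assert (Inj : forall d d' v, app q d v -> app q d' v -> d = d').
    { intros d d' v Hd Hd'.
      assert (Od := ord_mem Hc (proj1 (maps_dom (proj1 Hq) Hd))).
      assert (Od' := ord_mem Hc (proj1 (maps_dom (proj1 Hq) Hd'))).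
      destruct (ord_tricho Od Od') as [E|[E|E]]; [exfalso|exact E|exfalso].
      - apply (proj1 (proj2 (proj2 Hq _ _ Hd')) _ E Hd).
      - apply (proj1 (proj2 (proj2 Hq _ _ Hd)) _ E Hd'). }
    destruct (@choice_into_ord (fun s d => forall v, app g s v ->
      (exists d', app q d' v) -> app q d v) Y t) as [f [Hf HfR]]; [def|exact Ht| |].
    - intros s Hs; destruct (maps_tot Hg Hs) as [v [Hv _]].
      destruct (classic (exists d', app q d' v)) as [[d Hd]|N].
      + exists d; split; [apply (maps_dom (proj1 Hq) Hd)|].
        intros v' Hv' _; rewrite (maps_fun Hg Hv' Hv); exact Hd.
      + (* values missed by the enumeration are sent to an arbitrary stage *)
        apply not_all_not_ex in Hne; destruct Hne as [z Hz].
        exists z; split; [exact Hz|]; intros v' Hv' He.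
        rewrite (maps_fun Hg Hv' Hv) in He; tauto.
    - exists f; split; [exact Hf|]; intros d Hd.
      destruct (maps_tot (proj1 Hq) Hd) as [v [Hv _]].
      destruct (proj1 (proj2 Hq _ _ Hv)) as [s Hs].
      assert (HsY := proj1 (maps_dom Hg Hs)).
      destruct (maps_tot Hf HsY) as [d' [Hd' _]].
      exists s; split; [exact HsY|].
      replace d with d'; [exact Hd'|].
      apply (Inj d' d v); [|exact Hv]; apply (HfR s d' Hd' v Hs); eauto. }
  exists c, q; split; [exact Hlt|split; [apply Hq|]].
  destruct H as [-> | H]; [destruct (mem_irrefl Hlt)|].
  intros x Hx; destruct (Hcof x Hx) as [s [a [Ha Hxa]]].
  destruct (H a) as [d [Hd Hda]]; [exists s; exact Ha|].
  exists d, a; auto.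
Qed.

End Enumeration.

(** * Rank systems *)

Section Systems.
Variable p : rank_data M.
Hypothesis Hp : rank_common p.

Lemma rj_ord d : rDD p d -> Ord (rj p d).
Proof.
  intros Hd; destruct (rc_j_lt Hp Hd) as [k [[Hk _] H]]; exact (ord_mem Hk H).
Qed.

Lemma DD_ge_trans i j e : DD_ge p j e -> ole i j -> DD_ge p i e.
Proof.
  intros [He Hj] Hij; split; [exact He|exact (ole_trans (rj_ord He) Hij Hj)].
Qed.

Lemma ord_fun_of_maps d f (W : M) (P : M -> Prop) :
  Ord W -> maps f (rY p d) P -> (forall a, P a -> a ∈ W) -> ord_fun p d f.
Proof.
  intros HW Hf HP; apply (maps_weaken Hf); intros x y Hxy.
  apply (ord_mem HW), HP, (maps_dom Hf Hxy).
Qed.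

Lemma rk_mono d f g C :
  rDD p d -> ord_fun p d f -> ord_fun p d g -> C ∈ rD p d ->
  (forall s a b, s ∈ C -> app f s a -> app g s b -> ole a b) ->
  ole (rk p d f) (rk p d g).
Proof.
  intros Hd Hf Hg HC H; apply (rc_rk_mono Hp Hd Hf Hg).
  destruct (@separation (fun s => exists a b, app f s a /\ app g s b /\ ole a b)
    (rY p d)) as [A HA]; [def|].
  exists A; split; [|exact HA].
  apply (filter_upward (rc_filter Hp Hd) HC).
  - intros s Hs; assert (HsY := filter_subset (rc_filter Hp Hd) HC Hs).
    destruct (maps_tot Hf HsY) as [a [Ha _]], (maps_tot Hg HsY) as [b [Hb _]].
    apply HA; split; [exact HsY|]; exists a, b; split; [exact Ha|split; [exact Hb|]].
    exact (H s a b Hs Ha Hb).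
  - intros s Hs; apply HA, Hs.
Qed.

Lemma rk_eq_mod d f g C :
  rDD p d -> ord_fun p d f -> ord_fun p d g -> C ∈ rD p d ->
  (forall s a, s ∈ C -> app f s a -> app g s a) ->
  rk p d f = rk p d g.
Proof.
  intros Hd Hf Hg HC H.
  assert (E : forall s a b, s ∈ C -> app f s a -> app g s b -> a = b).
  { intros s a b Hs Ha Hb; exact (maps_fun Hg (H s a Hs Ha) Hb). }
  assert (H1 : ole (rk p d f) (rk p d g)).
  { apply (rk_mono Hd Hf Hg HC); intros s a b Hs Ha Hb; right; eauto. }
  assert (H2 : ole (rk p d g) (rk p d f)).
  { apply (rk_mono Hd Hg Hf HC); intros s a b Hs Ha Hb; right; symmetry; eauto. }
  destruct H1 as [H1|H1]; [|exact H1].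
  destruct (ole_not_mem H2 H1).
Qed.

Lemma const_ex d a : Ord a -> exists f, is_const f (rY p d) a /\ ord_fun p d f.
Proof.
  intros Ha; destruct (succ_ex Ha) as [a' [Hs Ha']].
  destruct (@choice_into_ord (fun _ y => y = a) (rY p d) a') as [f [Hf Hfa]];
    [def|exact Ha'| |].
  - intros x _; exists a; split; [apply Hs; right; reflexivity|reflexivity].
  - exists f; split; [exact (maps_weaken Hf Hfa)|].
    exact (ord_fun_of_maps Ha' Hf (fun a H => H)).
Qed.

Lemma const_ord_fun d f a : Ord a -> is_const f (rY p d) a -> ord_fun p d f.
Proof.
  intros Ha Hf; apply (maps_weaken Hf); intros x y Hxy.
  rewrite (proj2 (maps_dom Hf Hxy)); exact Ha.
Qed.

(** A property that holds on a set of the filter may be assumed to hold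
    everywhere: filters are proper, so a value with the property is at hand to
    overwrite the others. *)
Lemma almost_everywhere (P : M -> Prop) e g C (W : M) :
  rDD p e -> ord_fun p e g -> C ∈ rD p e -> Ord W -> definable1 P ->
  (forall t, t ∈ C -> exists a, app g t a /\ a ∈ W /\ P a) ->
  exists g', maps g' (rY p e) (fun a => a ∈ W /\ P a) /\ rk p e g' = rk p e g.
Proof.
  intros He Hg HC HW HP H.
  assert (Hne := filter_proper (rc_filter Hp He) HC).
  apply not_all_not_ex in Hne; destruct Hne as [t0 Ht0].
  destruct (H t0 Ht0) as [a0 [_ Ha0]].
  destruct (@choice_into_ord (fun t a => P a /\ (t ∈ C -> app g t a)) (rY p e) W)
    as [g' [Hg' HR]]; [def|exact HW| |].
  { intros t _; destruct (classic (t ∈ C)) as [Ht|Ht].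
    - destruct (H t Ht) as [a Ha]; exists a; tauto.
    - exists a0; tauto. }
  exists g'; split.
  - apply (maps_weaken Hg'); intros t a Ha; split; [apply (maps_dom Hg' Ha)|].
    apply (HR t a Ha).
  - apply (rk_eq_mod He (ord_fun_of_maps HW Hg' (fun a H => H)) Hg HC).
    intros t a Ht Ha; apply (HR t a Ha), Ht.
Qed.

(** A colouring of the possible values of [f] becomes constant after passing to
    some [e], without changing the rank.  Colouring values instead of points
    makes this meaningful for both kinds of systems: neither [Σ] nor a change
    of the underlying set is visible in it. *)
Definition colour_completeness : Prop :=
  forall sigma, sigma ∈ rmu p ->
  exists i, lt_cf i (rmu p) /\
  forall d f (W : M) (P : M -> M -> Prop),
    DD_ge p i d -> Ord W -> maps_into f (rY p d) W -> definable2 P ->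
    (forall a, a ∈ W -> exists j, j ∈ sigma /\ P a j) ->
    exists e k j, DD_ge p (rj p d) e /\ j ∈ sigma /\
      maps k (rY p e) (fun a => a ∈ W /\ P a j) /\ rk p e k = rk p d f.

Definition const_no_hole : Prop :=
  forall d f a zeta, rDD p d -> Ord a -> is_const f (rY p d) a ->
    zeta ∈ rk p d f ->
    exists e g, DD_ge p (rj p d) e /\ maps_into g (rY p e) a /\ rk p e g = zeta.

Lemma partition_of_map (F X Y : M) :
  maps_into F Y X ->
  exists A, partition A X Y /\ forall j B, app A j B -> forall z, z ∈ B <-> app F z j.
Proof.
  intros HF.
  destruct (@function_ex (fun j B => forall z, z ∈ B <-> app F z j) X)
    as [A [HA Happ]]; [def| |].
  { intros j Hj; destruct (@separation (fun z => app F z j) Y) as [B HB]; [def|].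
    assert (HB' : forall z, z ∈ B <-> app F z j).
    { intros z; rewrite HB; split; [tauto|]; intros Hz; split; [|exact Hz].
      exact (proj1 (maps_dom HF Hz)). }
    exists B; split; [exact HB'|]; intros B' H.
    apply (ZF_extensionality ZM); intros z; rewrite HB', H; reflexivity. }
  assert (HAB : forall j B, app A j B -> forall z, z ∈ B <-> app F z j).
  { intros j B H; apply Happ in H; apply H. }
  exists A; split; [split; [|split]|exact HAB].
  - apply (maps_weaken HA); intros j B H z Hz.
    apply (HAB j B H) in Hz; exact (proj1 (maps_dom HF Hz)).
  - intros s Hs; destruct (maps_tot HF Hs) as [j [Hj HjX]].
    destruct (maps_tot HA HjX) as [B [HB _]].
    exists j, B; split; [exact HB|]; apply (HAB j B HB), Hj.
  - intros j j' B B' s HB HB' Hs Hs'.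
    apply (HAB j B HB) in Hs; apply (HAB j' B' HB') in Hs'.
    exact (maps_fun HF Hs Hs').
Qed.

Lemma colour_partition f Y (W X : M) (P : M -> M -> Prop) :
  Ord W -> Ord X -> maps_into f Y W -> definable2 P ->
  (forall a, a ∈ W -> exists j, j ∈ X /\ P a j) ->
  exists A, partition A X Y /\
    forall j B s, app A j B -> s ∈ B -> exists a, app f s a /\ a ∈ W /\ P a j.
Proof.
  intros HW HX Hf HP Htot.
  destruct (@choice_into_ord (fun s j => exists a, app f s a /\ P a j) Y X)
    as [F [HF HFP]]; [def|exact HX| |].
  { intros s Hs; destruct (maps_tot Hf Hs) as [a [Ha HaW]].
    destruct (Htot a HaW) as [j [Hj HjP]]; exists j; split; [exact Hj|].
    exists a; auto. }
  destruct (partition_of_map HF) as [A [HA HAB]].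
  exists A; split; [exact HA|]; intros j B s HB Hs.
  apply (HAB j B HB) in Hs; destruct (HFP s j Hs) as [a [Ha HaP]].
  exists a; split; [exact Ha|split; [apply (maps_dom Hf Ha)|exact HaP]].
Qed.

End Systems.

Lemma definable1_at (P : M -> M -> Prop) j :
  definable2 P -> definable1 (fun a => P a j).
Proof. intros HP; def. Qed.

Lemma definable1_True : definable1 (fun _ : M => ~ False).
Proof.
  destruct (ZF_infinity ZM) as [w _]; def.
Qed.

Lemma colour_completeness1 (p : rank1_data M) :
  weak_rank1_system p -> colour_completeness p.
Proof.
  intros Hw sigma Hs; assert (Hp := w1_common Hw).
  assert (Os := ord_mem (proj1 (proj1 (rc_mu Hp))) Hs).
  destruct (w1_complete Hw Hs) as [i [Hi Hcomp]].
  exists i; split; [exact Hi|]; intros d f W P Hd HW Hf HP Htot.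
  destruct (colour_partition HW Os Hf HP Htot) as [A [HA HAP]].
  assert (Of : ord_fun p d f) by exact (ord_fun_of_maps HW Hf (fun a H => H)).
  destruct (Hcomp d Hd f A Of HA) as [e [j [B [He [Hj [HB [HBD Hrk]]]]]]].
  destruct (w1_Sigma Hw (proj1 Hd) He) as [De [HY Hle]].
  assert (Of' : ord_fun p e f) by (unfold ord_fun; rewrite HY; exact Of).
  destruct (almost_everywhere (P := fun a => P a j) Hp De Of' HBD HW)
    as [k [Hk Hkr]]; [exact (definable1_at j HP)|eauto|].
  exists e, k, j; split; [split; auto|]; split; [exact Hj|]; split; [exact Hk|congruence].
Qed.

Lemma const_no_hole1 (p : rank1_data M) : weak_rank1_system p -> const_no_hole p.
Proof.
  intros Hw d f a zeta Hd Ha Hf Hz; assert (Hp := w1_common Hw).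
  destruct (w1_no_hole Hw Hd (const_ord_fun Ha Hf) Hz)
    as [e [g [He [Hg [[C [HC HCg]] Hrk]]]]].
  destruct (w1_Sigma Hw Hd He) as [De [HY Hle]].
  destruct (almost_everywhere (P := fun _ => ~ False) Hp De Hg HC Ha) as [g' [Hg' Hr']].
  - exact definable1_True.
  - intros t Ht; apply HCg in Ht; destruct Ht as [_ [x [y [Hx [Hy Hxy]]]]].
    rewrite (proj2 (maps_dom Hf Hy)) in Hxy; exists x; tauto.
  - exists e, g'; split; [split; auto|]; split; [|congruence].
    apply (maps_weaken Hg'); intros t x Hx; apply (maps_dom Hg' Hx).
Qed.

Lemma comp_maps k f h Y' Y (B : M -> Prop) :
  maps_into h Y' Y -> maps f Y B -> is_comp k f h ->
  maps k Y' B /\ forall t a, app k t a <-> exists s, app h t s /\ app f s a.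
Proof.
  intros Hh Hf Hk.
  assert (Happ : forall t a, app k t a <-> exists s, app h t s /\ app f s a).
  { intros t a; split.
    - intros [q [Hq Hqk]]; apply Hk in Hqk.
      destruct Hqk as [t' [s [a' [Hq' H]]]].
      destruct (opair_inj Hq Hq') as [-> ->]; eauto.
    - intros [s [Ht Hs]]; destruct (opair_ex t a) as [q Hq].
      exists q; split; [exact Hq|]; apply Hk; exists t, s, a; auto. }
  split; [split|exact Happ].
  - intros q Hq; apply Hk in Hq; destruct Hq as [t [s [a [Hq [Ht Hs]]]]].
    exists t, a; split; [exact Hq|].
    split; [apply (maps_dom Hh Ht)|apply (maps_dom Hf Hs)].
  - intros t Ht; destruct (maps_tot Hh Ht) as [s [Hs HsY]].
    destruct (maps_tot Hf HsY) as [a [Ha _]].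
    exists a; split; [apply Happ; eauto|].
    intros a' Ha'; apply Happ in Ha'; destruct Ha' as [s' [Hs' Ha']].
    rewrite (maps_fun Hh Hs' Hs) in Ha'; exact (maps_fun Hf Ha Ha').
Qed.

Lemma colour_completeness2 (p : rank2_data M) :
  weak_rank2_system p -> colour_completeness p.
Proof.
  intros Hw sigma Hs; assert (Hp := w2_common Hw).
  assert (Os := ord_mem (proj1 (proj1 (rc_mu Hp))) Hs).
  destruct (w2_complete Hw Hs) as [i [Hi Hcomp]].
  exists i; split; [exact Hi|]; intros d f W P Hd HW Hf HP Htot.
  destruct (colour_partition HW Os Hf HP Htot) as [A [HA HAP]].
  assert (Of : ord_fun p d f) by exact (ord_fun_of_maps HW Hf (fun a H => H)).
  destruct (Hcomp d Hd f A Of HA)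
    as [e [h [j [B [C [k [He [Hj [HB [HC [HCD [Hk Hrk]]]]]]]]]]]].
  destruct (w2_Sigma Hw (proj1 Hd) He) as [De Hh].
  destruct (comp_maps Hh Of Hk) as [Ok Hkapp].
  destruct (almost_everywhere (P := fun a => P a j) Hp (proj1 De) Ok HCD HW)
    as [k' [Hk' Hkr]].
  - exact (definable1_at j HP).
  - intros t Ht; apply HC in Ht; destruct Ht as [_ [s [Hts HsB]]].
    destruct (HAP j B s HB HsB) as [a [Ha H]]; exists a; split; [|exact H].
    apply Hkapp; eauto.
  - exists e, k', j; split; [exact De|]; split; [exact Hj|]; split; [exact Hk'|congruence].
Qed.

Lemma const_no_hole2 (p : rank2_data M) : weak_rank2_system p -> const_no_hole p.
Proof.
  intros Hw d f a zeta Hd Ha Hf Hz; assert (Hp := w2_common Hw).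
  destruct (w2_no_hole Hw Hd (const_ord_fun Ha Hf) Hz)
    as [e [h [g [k [He [Hg [Hk [[C [HC HCg]] Hrk]]]]]]]].
  destruct (w2_Sigma Hw Hd He) as [De Hh].
  destruct (comp_maps Hh Hf Hk) as [Ck _].
  destruct (almost_everywhere (P := fun _ => ~ False) Hp (proj1 De) Hg HC Ha) as [g' [Hg' Hr']].
  - exact definable1_True.
  - intros t Ht; apply HCg in Ht; destruct Ht as [_ [x [y [Hx [Hy Hxy]]]]].
    rewrite (proj2 (maps_dom Ck Hy)) in Hxy; exists x; tauto.
  - exists e, g'; split; [exact De|]; split; [|congruence].
    apply (maps_weaken Hg'); intros t x Hx; apply (maps_dom Hg' Hx).
Qed.

(** * Fixed points of the ranks *)

Section FixedPoints.
Variable p : rank_data M.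
Hypothesis Hp : rank_common p.
Hypothesis Hcol : colour_completeness p.
Hypothesis Hhole : const_no_hole p.

Let mu_ord : Ord (rmu p) := proj1 (proj1 (rc_mu Hp)).
Let DD_def := rc_DD_definable Hp.
Let Y_def := rc_Y_definable Hp.
Let j_def := rc_j_definable Hp.
Let rk_def := rc_rk_definable Hp.

Lemma cf_mu : exists k, is_cf (rmu p) k /\ k ∈ rmu p.
Proof. exact (proj2 (proj2 (rc_mu Hp))). Qed.

Lemma lt_cf_iff k i : is_cf (rmu p) k -> (lt_cf i (rmu p) <-> i ∈ k).
Proof.
  intros Hk; split; [|exists k; auto].
  intros [k' [Hk' Hi]]; rewrite (cf_uniq Hk Hk'); exact Hi.
Qed.

(** For a least [a] of rank [b < a], the constants [b] and [b + 1] would give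
    [b <= rk(b) < rk(b + 1) <= rk(a) = b]. *)
Lemma le_rk_const d a f :
  rDD p d -> Ord a -> is_const f (rY p d) a -> ole a (rk p d f).
Proof.
  intros Hd Ha; revert f; revert a Ha.
  enough (H : forall a, Ord a -> forall f r, is_const f (rY p d) a ->
    (rDD p d /\ ord_fun p d f /\ r = rk p d f) -> ole a r).
  { intros a Ha f Hf; apply (H a Ha f); eauto using const_ord_fun. }
  apply (@ord_induction (fun a => forall f r, is_const f (rY p d) a ->
    (rDD p d /\ ord_fun p d f /\ r = rk p d f) -> ole a r)); [def|].
  intros a Ha IH f r Hf [_ [Of ->]].
  destruct (@ole_or_mem a (rk p d f)) as [H|Hb];
    [exact Ha|exact (rc_rk_ord Hp Hd Of)|exact H|exfalso].
  assert (Ob := ord_mem Ha Hb).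
  destruct (succ_ex Ob) as [b' [Hs Ob']].
  destruct (@const_ex p d (rk p d f) Ob) as [g [Hg Og]].
  destruct (@const_ex p d b' Ob') as [g' [Hg' Og']].
  assert (HY := filter_full (rc_filter Hp Hd)).
  assert (H1 := IH _ Hb g _ Hg (conj Hd (conj Og eq_refl))).
  assert (H2 : is_succ (rk p d g) (rk p d g')).
  { apply (rc_rk_succ Hp Hd Og' Og); exists (rY p d); split; [exact HY|].
    intros s; split; [|tauto]; intros Hsy; split; [exact Hsy|].
    destruct (maps_tot Hg' Hsy) as [x [Hx ->]], (maps_tot Hg Hsy) as [y [Hy ->]].
    eauto. }
  assert (H3 : ole (rk p d g') (rk p d f)).
  { apply (rk_mono Hp Hd Og' Of HY); intros s x y _ Hx Hy.
    rewrite (proj2 (maps_dom Hg' Hx)), (proj2 (maps_dom Hf Hy)).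
    destruct (ole_or_mem Ob' Ha) as [H|H]; [exact H|exfalso].
    apply Hs in H; exact (ole_not_mem H Hb). }
  apply (@mem_irrefl (rk p d f)).
  apply (ole_mem_trans Ob H1); refine (mem_ole_trans Ob _ H3).
  apply H2; auto.
Qed.

(** [a] is fixed by all ranks from [i] on; written with graphs only, so that it
    is visibly definable. *)
Definition fixed_from (i a : M) : Prop :=
  forall d w y, (rDD p d /\ w = rj p d) -> ole i w -> (rDD p d /\ y = rY p d) ->
  exists f, is_const f y a /\ (rDD p d /\ ord_fun p d f /\ a = rk p d f).

Lemma fixed_from_definable : definable2 fixed_from.
Proof. pose (rmu p); unfold fixed_from; def. Qed.

Lemma fixed_from_iff i a :
  Ord a -> (fixed_from i a <-> forall d, DD_ge p i d -> rk_const p d a a).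
Proof.
  intros Ha; split.
  - intros H d [Hd Hi]; destruct (H d _ _ (conj Hd eq_refl) Hi (conj Hd eq_refl))
      as [f [Hf [_ [_ E]]]]; exists f; auto.
  - intros H d w y [Hd ->] Hi [_ ->]; destruct (H d (conj Hd Hi)) as [f [Hf E]].
    exists f; eauto using const_ord_fun.
Qed.

Lemma fixed_from_mono i j a :
  Ord a -> ole i j -> fixed_from i a -> fixed_from j a.
Proof.
  intros Ha Hij; rewrite !fixed_from_iff by exact Ha; intros H d Hd.
  exact (H d (DD_ge_trans Hp Hd Hij)).
Qed.

Lemma rk_le_fixed i a d g :
  Ord a -> fixed_from i a -> DD_ge p i d -> ord_fun p d g ->
  (forall t b, app g t b -> ole b a) -> ole (rk p d g) a.
Proof.
  intros Ha Hfix Hd Hg Hb.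
  destruct (proj1 (fixed_from_iff i Ha) Hfix d Hd) as [f [Hf E]].
  rewrite <- E.
  apply (rk_mono Hp (proj1 Hd) Hg (const_ord_fun Ha Hf)
    (filter_full (rc_filter Hp (proj1 Hd)))).
  intros t x y _ Hx Hy; rewrite (proj2 (maps_dom Hf Hy)); eauto.
Qed.

(** If the rank moves [zeta], it moves it up, and there are no holes. *)
Lemma small_fun_of_moved d zeta :
  rDD p d -> Ord zeta -> ~ rk_const p d zeta zeta ->
  exists e g, DD_ge p (rj p d) e /\ maps_into g (rY p e) zeta /\ rk p e g = zeta.
Proof.
  intros Hd Hz N; destruct (@const_ex p d zeta Hz) as [f [Hf Of]].
  destruct (le_rk_const Hd Hz Hf) as [H|H]; [exact (Hhole Hd Hz Hf H)|].
  destruct N; exists f; auto.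
Qed.

(** A bound below [zeta] comes from completeness, which selects one term of a
    cofinal sequence, when [zeta] has cofinality below [μ].  Otherwise no image
    of a set [Y_e] is cofinal in [zeta], since [θ(Y_e) < μ]. *)
Lemma bounded_fun_of_moved zeta :
  Ord zeta ->
  exists i, lt_cf i (rmu p) /\ forall d, DD_ge p i d -> ~ rk_const p d zeta zeta ->
  exists e g x, DD_ge p (rj p d) e /\ x ∈ zeta /\
    maps g (rY p e) (fun a => a ∈ zeta /\ ole a x) /\ rk p e g = zeta.
Proof.
  intros Hz.
  destruct (classic (exists b c, b ∈ rmu p /\ cofinal_map c b zeta))
    as [[b [c [Hb [Hc Hcof]]]]|N].
  - destruct (Hcol Hb) as [i [Hi H]].
    exists i; split; [exact Hi|]; intros d Hd Nd.
    destruct (small_fun_of_moved (proj1 Hd) Hz Nd) as [e0 [g0 [He0 [Hg0 E0]]]].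
    destruct (H e0 g0 zeta (fun a j => forall x, app c j x -> ole a x))
      as [e [g [j [He [Hj [Hg E]]]]]].
    + exact (DD_ge_trans Hp He0 (proj2 Hd)).
    + exact Hz.
    + exact Hg0.
    + def.
    + intros a Ha; destruct (Hcof a Ha) as [j [y [Hj [Hy Hay]]]].
      exists j; split; [exact Hj|]; intros x Hx; rewrite (maps_fun Hc Hx Hy); exact Hay.
    + destruct (maps_tot Hc Hj) as [x [Hx Hxz]].
      exists e, g, x; split; [exact (DD_ge_trans Hp He (proj2 He0))|].
      split; [exact Hxz|]; split; [|congruence].
      apply (maps_weaken Hg); intros t a Ha.
      destruct (proj2 (maps_dom Hg Ha)) as [H1 H2]; auto.
  - destruct cf_mu as [k [_ Hk]].
    destruct (Hcol Hk) as [i [Hi _]].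
    exists i; split; [exact Hi|]; intros d Hd Nd.
    destruct (small_fun_of_moved (proj1 Hd) Hz Nd) as [e [g [He [Hg E]]]].
    destruct (classic (exists x, x ∈ zeta /\ forall t a, app g t a -> ole a x))
      as [[x [Hx Hgx]]|Nx].
    + exists e, g, x; split; [exact He|]; split; [exact Hx|]; split; [|exact E].
      apply (maps_weaken Hg); intros t a Ha.
      split; [apply (maps_dom Hg Ha)|eauto].
    + exfalso; apply N.
      destruct (rc_theta Hp (proj1 He)) as [t [Ht Htm]].
      destruct (cofinal_below_theta Hg Hz Ht) as [b [c [Hb Hc]]].
      * intros x Hx; apply NNPP; intros N'; apply Nx; exists x; split; [exact Hx|].
        intros s a Ha; apply NNPP; intros N''; apply N'; exists s, a.
        split; [exact Ha|].
        assert (Oa := ord_mem Hz (proj2 (maps_dom Hg Ha))).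
        destruct (ole_or_mem Oa (ord_mem Hz Hx)) as [H|H]; [tauto|left; exact H].
      * exists b, c; split; [exact (ord_trans mu_ord Hb Htm)|exact Hc].
Qed.

Lemma lt_cf_ord i : lt_cf i (rmu p) -> Ord i.
Proof. intros [k [[Hk _] Hi]]; exact (ord_mem Hk Hi). Qed.

Lemma lt_cf_max i j :
  lt_cf i (rmu p) -> lt_cf j (rmu p) ->
  exists m, lt_cf m (rmu p) /\ ole i m /\ ole j m.
Proof.
  intros Hi Hj; destruct (max_ex (lt_cf_ord Hi) (lt_cf_ord Hj))
    as [m [[-> | ->] H]]; eauto.
Qed.

Lemma fixed_of_cofinal zeta i :
  Ord zeta -> lt_cf i (rmu p) ->
  (forall x, x ∈ zeta -> exists y, y ∈ zeta /\ ole x y /\ fixed_from i y) ->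
  exists j, lt_cf j (rmu p) /\ fixed_from j zeta.
Proof.
  intros Hz Hi Hcof; destruct (bounded_fun_of_moved Hz) as [i' [Hi' H]].
  destruct (lt_cf_max Hi Hi') as [m [Hm [Him Hi'm]]].
  exists m; split; [exact Hm|]; apply (fixed_from_iff m Hz); intros d Hd.
  apply NNPP; intros N.
  destruct (H d (DD_ge_trans Hp Hd Hi'm) N) as [e [g [x [He [Hx [Hg E]]]]]].
  destruct (Hcof x Hx) as [y [Hy [Hxy Hfix]]].
  assert (Oy := ord_mem Hz Hy).
  assert (Hle : ole (rk p e g) y).
  { apply (rk_le_fixed (i := i) Oy Hfix).
    - apply (DD_ge_trans Hp He), (DD_ge_trans Hp Hd Him).
    - apply (ord_fun_of_maps Hz Hg); tauto.
    - intros t b Hb; apply (ole_trans Oy) with (2 := Hxy).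
      apply (maps_dom Hg Hb). }
  rewrite E in Hle; exact (ole_not_mem Hle Hy).
Qed.

(** When each stage fixes only a bounded part of [zeta] while every element is
    fixed from some stage on, the bounds form a cofinal sequence of length
    [cf(μ)], and regularity of [cf(μ)] excludes shorter ones. *)
Lemma cf_of_bounded_stages k zeta :
  Ord zeta -> is_cf (rmu p) k ->
  (forall y, y ∈ zeta -> exists i, i ∈ k /\ fixed_from i y) ->
  (forall i, i ∈ k -> exists x, x ∈ zeta /\
     forall y, y ∈ zeta -> fixed_from i y -> y ∈ x) ->
  is_cf zeta k.
Proof.
  intros Hz Hk Hfix Hbd; assert (F_def := fixed_from_definable).
  split; [apply Hk|split].
  - apply (@cofinal_map_of_rel
      (fun i x => forall y, y ∈ zeta -> fixed_from i y -> y ∈ x));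
      [def|exact Hz|exact Hbd|].
    intros x Hx; destruct (Hfix x Hx) as [i [Hi Hix]].
    exists i; split; [exact Hi|]; intros y _ Hy; left; auto.
  - intros b Hb [c [Hc Hcof]].
    destruct (@cf_regular (rmu p) k b (fun z i => forall y, app c z y -> fixed_from i y))
      as [w [Hw H]]; [exact mu_ord|exact Hk|exact Hb|def| |].
    + intros z Hzb; destruct (maps_tot Hc Hzb) as [y [Hy Hyz]].
      destruct (Hfix y Hyz) as [i [Hi Hiy]]; exists i; split; [exact Hi|].
      intros y' Hy'; rewrite (maps_fun Hc Hy' Hy); exact Hiy.
    + destruct (Hbd w Hw) as [x [Hx Hxb]].
      destruct (Hcof x Hx) as [z [y [Hzb [Hy Hxy]]]].
      destruct (H z Hzb) as [i [Hi [Hiw Hiy]]].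
      assert (Hyz := proj2 (maps_dom Hc Hy)).
      apply (ole_not_mem Hxy), Hxb; [exact Hyz|].
      exact (fixed_from_mono (ord_mem Hz Hyz) Hiw (Hiy y Hy)).
Qed.

Lemma fixed_of_bounded_stages zeta :
  strictness p -> Ord zeta ->
  (forall y, y ∈ zeta -> exists i, lt_cf i (rmu p) /\ fixed_from i y) ->
  (forall i, lt_cf i (rmu p) -> exists x, x ∈ zeta /\
     forall y, y ∈ zeta -> fixed_from i y -> y ∈ x) ->
  exists j, lt_cf j (rmu p) /\ fixed_from j zeta.
Proof.
  intros Hst Hz Hfix Hbd; assert (F_def := fixed_from_definable).
  destruct cf_mu as [k [Hk Hkm]].
  assert (Hcf : is_cf zeta k).
  { apply (cf_of_bounded_stages Hz Hk).
    - intros y Hy; destruct (Hfix y Hy) as [i [Hi H]].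
      exists i; split; [apply (lt_cf_iff i Hk), Hi|exact H].
    - intros i Hi; apply Hbd, (lt_cf_iff i Hk), Hi. }
  assert (Hlim : forall x, x ∈ zeta -> exists y, y ∈ zeta /\ x ∈ y).
  { intros x Hx; destruct (Hfix x Hx) as [i [Hi H]].
    destruct (Hbd i Hi) as [y [Hy Hxy]]; exists y; auto. }
  apply NNPP; intros N.
  assert (Hmoved : forall i, lt_cf i (rmu p) ->
    exists d, DD_ge p i d /\ ~ rk_const p d zeta zeta).
  { intros i Hi; apply NNPP; intros N'; apply N; exists i; split; [exact Hi|].
    apply (fixed_from_iff i Hz); intros d Hd; apply NNPP; intros N''; eauto. }
  destruct (bounded_fun_of_moved Hz) as [i1 [Hi1 Hbf]].
  destruct (Hcol Hkm) as [i2 [Hi2 Hck]].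
  destruct (lt_cf_max Hi1 Hi2) as [m [Hm [Hm1 Hm2]]].
  destruct (Hmoved m Hm) as [d [Hd Nd]].
  destruct (Hbf d (DD_ge_trans Hp Hd Hm1) Nd) as [e [g [x [He [Hx [Hg E]]]]]].
  destruct (Hlim x Hx) as [xi [Hxi Hxxi]]; assert (Oxi := ord_mem Hz Hxi).
  assert (Hgxi : maps_into g (rY p e) xi).
  { apply (maps_weaken Hg); intros t a Ha.
    apply (ole_mem_trans Oxi) with (2 := Hxxi), (maps_dom Hg Ha). }
  (* colour the values by the stage from which they are fixed *)
  destruct (Hck e g xi (fun a j => fixed_from j a))
    as [e' [f [j0 [He' [Hj0 [Hf Ef]]]]]].
  { exact (DD_ge_trans Hp (DD_ge_trans Hp He (proj2 Hd)) Hm2). }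
  { exact Oxi. }
  { exact Hgxi. }
  { def. }
  { intros a Ha; destruct (Hfix a (ord_trans Hz Ha Hxi)) as [i [Hi H]].
    exists i; split; [apply (lt_cf_iff i Hk), Hi|exact H]. }
  apply (lt_cf_iff j0 Hk) in Hj0.
  destruct (Hst e' zeta xi f j0) as [j [Hjj [Hj Hno]]].
  - apply He'.
  - exact Hz.
  - exact Oxi.
  - apply (maps_weaken Hf); intros t a Ha; apply (maps_dom Hf Ha).
  - congruence.
  - exact Hxi.
  - exists k; auto.
  - exact Hj0.
  - intros s a d' Hs Ha Hd'; destruct (maps_dom Hf Ha) as [_ [Haxi Hfa]].
    exact (proj1 (fixed_from_iff j0 (ord_mem Oxi Haxi)) Hfa d' Hd').
  - destruct (lt_cf_max Hi1 Hj) as [n [Hn [Hn1 Hnj]]].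
    destruct (Hmoved n Hn) as [d' [Hd' Nd']].
    destruct (Hbf d' (DD_ge_trans Hp Hd' Hn1) Nd')
      as [e1 [g1 [x1 [He1 [Hx1 [Hg1 E1]]]]]].
    assert (Hb : exists b, b ∈ zeta /\ ole x1 b /\ ole xi b).
    { destruct (max_ex (ord_mem Hz Hx1) Oxi) as [b [[-> | ->] H]]; eauto. }
    destruct Hb as [b [Hb [Hx1b Hxib]]]; assert (Ob := ord_mem Hz Hb).
    destruct (Hlim b Hb) as [zeta' [Hz' Hbz']].
    assert (Oz' := ord_mem Hz Hz').
    (* [max(g1, xi)] has at least the rank of [g1] *)
    destruct (@choice_into_ord (fun t v => ole xi v /\ forall a, app g1 t a -> ole a v)
      (rY p e1) zeta') as [g2 [Hg2 Hg2R]]; [def|exact Oz'| |].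
    { intros t Ht; exists b; split; [exact Hbz'|]; split; [exact Hxib|].
      intros a Ha; apply (ole_trans Ob) with (2 := Hx1b), (maps_dom Hg1 Ha). }
    apply Hno; exists e1, g2.
    split; [apply (DD_ge_trans Hp He1), (DD_ge_trans Hp Hd' Hnj)|].
    split; [apply (maps_weaken Hg2); intros t a Ha;
            exact (ord_trans Hz (proj2 (maps_dom Hg2 Ha)) Hz')|].
    split.
    + exists zeta'; split; [exact Hz'|]; intros t a Ht Ha.
      exact (conj (proj1 (Hg2R t a Ha)) (proj2 (maps_dom Hg2 Ha))).
    + rewrite <- E1.
      apply (rk_mono (C := rY p e1) Hp (proj1 He1)).
      * apply (ord_fun_of_maps Hz Hg1); tauto.
      * exact (ord_fun_of_maps Oz' Hg2 (fun a H => H)).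
      * apply (filter_full (rc_filter Hp (proj1 He1))).
      * intros t a v _ Ha Hv; apply (Hg2R t v Hv), Ha.
Qed.

Theorem eventually_fixed :
  strictness p -> forall zeta, Ord zeta ->
  exists i, lt_cf i (rmu p) /\ forall d, DD_ge p i d -> rk_const p d zeta zeta.
Proof.
  intros Hst.
  assert (H : forall zeta, Ord zeta ->
    exists i, lt_cf i (rmu p) /\ fixed_from i zeta).
  { assert (F_def := fixed_from_definable).
    destruct cf_mu as [k [Hk _]].
    intros zeta Hz.
    enough (G : exists i, i ∈ k /\ fixed_from i zeta).
    { destruct G as [i [Hi G]]; exists i; split; [exists k|]; auto. }
    revert zeta Hz.
    apply (@ord_induction (fun zeta => exists i, i ∈ k /\ fixed_from i zeta)); [def|].
    intros zeta Hz IH.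
    enough (G : exists i, lt_cf i (rmu p) /\ fixed_from i zeta).
    { destruct G as [i [Hi G]]; exists i; split; [apply (lt_cf_iff i Hk)|]; auto. }
    destruct (classic (exists i, lt_cf i (rmu p) /\ forall x, x ∈ zeta ->
      exists y, y ∈ zeta /\ ole x y /\ fixed_from i y)) as [[i [Hi Hcof]]|N].
    - exact (fixed_of_cofinal Hz Hi Hcof).
    - apply (fixed_of_bounded_stages Hst Hz).
      + intros y Hy; destruct (IH y Hy) as [i [Hi H]].
        exists i; split; [exists k|]; auto.
      + intros i Hi; apply NNPP; intros N'; apply N; exists i; split; [exact Hi|].
        intros x Hx; apply NNPP; intros N''; apply N'; exists x; split; [exact Hx|].
        intros y Hy Hfix; apply NNPP; intros N3; apply N''; exists y.
        split; [exact Hy|split; [|exact Hfix]].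
        destruct (ole_or_mem (ord_mem Hz Hx) (ord_mem Hz Hy)); tauto. }
  intros zeta Hz; destruct (H zeta Hz) as [i [Hi Hfix]].
  exists i; split; [exact Hi|]; apply (fixed_from_iff i Hz), Hfix.
Qed.

End FixedPoints.
End Sets.

Theorem theorem3p10 (M : structure) (HM : ZF M) :
  (forall p : rank1_data M, strict_rank1_system p ->
     forall zeta : M, Ord zeta ->
     exists i : M, lt_cf i (rmu p) /\
       forall d : M, DD_ge p i d -> rk_const p d zeta zeta) /\
  (forall p : rank2_data M, strict_rank2_system p ->
     forall zeta : M, Ord zeta ->
     exists i : M, lt_cf i (rmu p) /\
       forall d : M, DD_ge p i d -> rk_const p d zeta zeta).
Proof.
  split; intros p [Hw Hst].
  - exact (eventually_fixed HM (w1_common Hw) (colour_completeness1 HM Hw)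
      (const_no_hole1 HM Hw) Hst).
  - exact (eventually_fixed HM (w2_common Hw) (colour_completeness2 HM Hw)
      (const_no_hole2 HM Hw) Hst).
Qed.
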